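(* Let $\mathcal{P}$ be a graded poset for which there exist an adequate local covering family and a global covering family $\mathcal{K}$. Then there exists a cochain complex $$0\rightarrow B^{\mathcal{K}}_0\xrightarrow{\Omega_0}B^{\mathcal{K}}_1\xrightarrow{\Omega_1}B^{\mathcal{K}}_2\xrightarrow{\Omega_2}\cdots$$ with $B^{\mathcal{K}}_n\cong\mathbb{Z}^{b^{\mathcal{K}}_n}$ for $n\ge0$, whose cohomology is $H^*(\mathcal{P};\mathbb{Z})$.
   Context: Posets. A poset is regarded as a category $\mathcal{P}$ with exactly one arrow $p\to p'$ if $p\le p'$ and none otherwise. For $p<p'$, $p$ precedes $p'$ if $p\le p''\le p'$ implies $p''=p$ or $p''=p'$. $\mathcal{P}$ is graded if it is equipped with a degree function $\deg:\mathrm{Ob}(\mathcal{P})\to\mathbb{Z}$ which is order reversing and satisfies $\deg(p)=\deg(p')+1$ whenever $p$ precedes $p'$. Standing assumptions on every graded poset: $\{p\mid p_0\le p\}$ is finite for every $p_0$, and $\deg$ takes values in $\{0,1,2,\ldots\}$. $\mathrm{Ob}_n(\mathcal{P})$ is the set of objects of degree $n$. $(p_0\downarrow\mathcal{P})$, $(p_0\downarrow\mathcal{P})_*$, $(p_0\downarrow\mathcal{P})_n$ are the full subcategories (also used for their sets of objects) on $\{p\mid p_0\le p\}$, $\{p\mid p_0<p\}$, $\{p\mid p_0\le p,\ \deg p=n\}$. $c_{\mathbb{Z}}$ is the constant functor with value $\mathbb{Z}$, and $H^*(\mathcal{P};\mathbb{Z})=\varprojlim^* c_{\mathbb{Z}}$,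 which equals the integral cohomology of the realization $|\mathcal{P}|$. Local covering families. A family $\mathcal{J}=\{J^{p_0}_n\}_{p_0\in\mathrm{Ob}(\mathcal{P}),\,0\le n\le\deg(p_0)}$ with $J^{p_0}_n\subseteq(p_0\downarrow\mathcal{P})_n$ is a local covering family if (a) for each $p_0$ and $0\le n<\deg(p_0)$, $\bigcup_{p\in J^{p_0}_{n+1}}(p\downarrow\mathcal{P})_n=(p_0\downarrow\mathcal{P})_n$; (b) for each $p_0$, $0\le n<\deg(p_0)$ and $p\in J^{p_0}_{n+1}$, $J^p_n\subseteq J^{p_0}_n$. Define numbers $R^{p_0}_n$ for $\deg(p_0)\ge n$ by $R^{p_0}_0=1$ and $R^{p_0}_n=\sum_{p\in(p_0\downarrow\mathcal{P})_{n-1}}R^p_{n-1}-R^{p_0}_{n-1}$ for $n\ge1$. $\mathcal{J}$ is adequate if $(p_0\downarrow\mathcal{P})_*$ is connected whenever $\deg(p_0)\ge2$, and $R^{p_0}_n=\sum_{p\in J^{p_0}_n}R^p_n$ for all $n\ge0$ and $\deg(p_0)\ge n+1$. The functors $F_n$. $F_0=c_{\mathbb{Z}}$, and for $n\ge1$, $F_n(p_0)$ is the cokernel of the map $F_{n-1}(p_0)\to\prod_{p\in(p_0\downarrow\mathcal{P})_{n-1}}F_{n-1}(p)$ with components $F_{n-1}(p_0\to p)$; arrows act by the maps induced by the projections between the products. Define $d_n:\prod_{p\in\mathrm{Ob}_n(\mathcal{P})}F_n(p)\to\prod_{q\in\mathrm{Ob}_{n+1}(\mathcal{P})}F_{n+1}(q)$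 by letting $d_n(x)_q$ be the class of $(x_p)_{p\in(q\downarrow\mathcal{P})_n}$ in $F_{n+1}(q)$. Global covering families. A map between free abelian groups is pure if its cokernel is a free abelian group. A global covering family is a family $\mathcal{K}=\{K_n\}_{n\ge0}$ with $K_n\subseteq\mathrm{Ob}_n(\mathcal{P})$ such that (1) the restriction map $\varprojlim F_n\to\prod_{p\in K_n}F_n(p)$ is injective for each $n\ge0$; (2) for each $n\ge1$ the map $\prod_{p\in\mathrm{Ob}_{n-1}(\mathcal{P})\setminus K_{n-1}}F_{n-1}(p)\to\prod_{p\in K_n}F_n(p)$, obtained from $d_{n-1}$ by precomposing with the inclusion (extension by zero) and postcomposing with the projection, is pure. The Betti numbers of $\mathcal{K}$ are $b^{\mathcal{K}}_0=\sum_{p\in K_0}R^p_0$ and $b^{\mathcal{K}}_n=\sum_{p\in K_{n-1}}R^p_{n-1}-\sum_{p\in\mathrm{Ob}_{n-1}(\mathcal{P})}R^p_{n-1}+\sum_{p\in K_n}R^p_n$ for $n\ge1$.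
   Formalization: It is additionally assumed that for each n only finitely many objects p of degree n have nonzero R^p_n, so that the sums defining the Betti numbers are finite; otherwise (e.g. an infinite discrete poset with K_0 = Ob_0) b_1 is the undefined expression infinity minus infinity. *)

(* Defs.v *)
From HB Require Import structures.
From mathcomp Require Import all_boot all_order all_algebra ring_quotient.
From mathcomp Require Import boolp classical_sets functions cardinality fsbigop.

Set Implicit Arguments.
Unset Strict Implicit.
Unset Printing Implicit Defensive.

Import Order.TTheory GRing.Theory Num.Theory.

Local Open Scope classical_set_scope.
Local Open Scope quotient_scope.
Local Open Scope ring_scope.

Section DProd.
Variables (I : Type) (G : I -> zmodType).

Definition dprod : Type := forall i, G i.

HB.instance Definition _ := Choice.copy dprod (forall i, G i).

Let dzero : dprod := fun=> 0.
Let dopp (x : dprod) : dprod := fun i => - x i.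
Let dadd (x y : dprod) : dprod := fun i => x i + y i.

Let daddA : associative dadd.
Proof. by move=> x y z; apply: functional_extensionality_dep => i; exact: addrA. Qed.
Let daddC : commutative dadd.
Proof. by move=> x y; apply: functional_extensionality_dep => i; exact: addrC. Qed.
Let dadd0 : left_id dzero dadd.
Proof. by move=> x; apply: functional_extensionality_dep => i; exact: add0r. Qed.
Let daddN : left_inverse dzero dopp dadd.
Proof. by move=> x; apply: functional_extensionality_dep => i; exact: addNr. Qed.

HB.instance Definition _ := GRing.isZmodule.Build dprod daddA daddC dadd0 daddN.

End DProd.

Definition subgroup_closed (V : zmodType) (A : set V) :=
  A 0 /\ forall x y, A x -> A y -> A (x - y).

Definition subgroup (V : zmodType) (A : set V) (_ : subgroup_closed A) : {pred V} :=
  fun x => `[< A x >].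

Lemma subgroup_zmod_closed (V : zmodType) (A : set V) (cA : subgroup_closed A) :
  zmod_closed (subgroup cA).
Proof.
case: (cA) => A0 AB; split; first exact/asboolP.
by move=> x y /asboolP Ax /asboolP Ay; apply/asboolP; exact: AB.
Qed.

HB.instance Definition _ (V : zmodType) (A : set V) (cA : subgroup_closed A) :=
  GRing.isZmodClosed.Build V (subgroup cA) (subgroup_zmod_closed cA).

Section SubQuot.
Variables (V : zmodType) (A : set V) (cA : subgroup_closed A).

Record sub_zmod := SubZmod { sub_val : V; sub_valP : sub_val \in subgroup cA }.

HB.instance Definition _ := [isSub for sub_val].
HB.instance Definition _ := [Choice of sub_zmod by <:].
HB.instance Definition _ := [SubChoice_isSubZmodule of sub_zmod by <:].

Definition quot_zmod : zmodType := Quotient.quot (subgroup cA).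

Lemma sub_valE (x : sub_zmod) : A (sub_val x).
Proof. exact/asboolP/sub_valP. Qed.

Definition to_sub (x : V) (Ax : A x) : sub_zmod := SubZmod (asboolT Ax).

Lemma sub_val_is_additive : zmod_morphism sub_val.
Proof. exact: (raddfB \val). Qed.

HB.instance Definition _ :=
  GRing.isZmodMorphism.Build sub_zmod V sub_val sub_val_is_additive.

Definition quot_class (x : V) : quot_zmod := \pi_(Quotient.quot (subgroup cA)) x.

Lemma quot_class_is_additive : zmod_morphism quot_class.
Proof. by move=> x y; rewrite /quot_class raddfB. Qed.

HB.instance Definition _ :=
  GRing.isZmodMorphism.Build V quot_zmod quot_class quot_class_is_additive.

Definition quot_repr (x : quot_zmod) : V := repr x.

Lemma quot_reprK x : quot_class (quot_repr x) = x.
Proof. exact: reprK. Qed.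

Lemma quot_class_eq0 x : quot_class x = 0 <-> A x.
Proof.
rewrite -(raddf0 quot_class) /quot_class.
split=> [/eqP|Ax]; last apply/eqP; rewrite -Quotient.idealrBE subr0; last exact/asboolP.
by move=> /asboolP.
Qed.

End SubQuot.

Section KerIm.
Variables (U V : zmodType) (f : {additive U -> V}).

Lemma ker_closed : subgroup_closed [set x | f x = 0].
Proof. by split=> [|x y /= fx fy]; rewrite /= ?raddf0 // raddfB fx fy subrr. Qed.

Lemma im_closed : subgroup_closed (range f).
Proof.
split=> [|_ _ [x _ <-] [y _ <-]]; first by exists 0; rewrite ?raddf0.
by exists (x - y); rewrite ?raddfB.
Qed.

Definition ker : zmodType := sub_zmod ker_closed.
Definition coker : zmodType := quot_zmod im_closed.

End KerIm.

Section CokerMap.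
Variables (U V U' V' : zmodType) (f : {additive U -> V}) (f' : {additive U' -> V'}).
Variables (b : {additive V -> V'}).

(* b_im is kept as an argument so that the additive structure can be inferred. *)
Definition coker_map (b_im : forall x, range f x -> range f' (b x)) (x : coker f) : coker f' :=
  quot_class (im_closed f') (b (quot_repr x)).

Hypothesis b_im : forall x, range f x -> range f' (b x).

Lemma coker_mapE x : coker_map b_im (quot_class (im_closed f) x) =
  quot_class (im_closed f') (b x).
Proof.
apply/eqP; rewrite -subr_eq0 -raddfB -raddfB; apply/eqP/quot_class_eq0/b_im.
by apply/(quot_class_eq0 (im_closed f)); rewrite raddfB /= quot_reprK subrr.
Qed.

Lemma coker_map_is_additive : zmod_morphism (coker_map b_im).
Proof.
move=> x y; rewrite -[x in LHS]quot_reprK -[y in LHS]quot_reprK -raddfB /=.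
by rewrite coker_mapE (raddfB b) raddfB.
Qed.

HB.instance Definition _ :=
  GRing.isZmodMorphism.Build (coker f) (coker f') (coker_map b_im) coker_map_is_additive.

End CokerMap.

Definition isomorphic (U V : zmodType) : Prop :=
  exists f : {additive U -> V}, bijective f.

(* E is a basis of V over the integers. *)
Definition free_abelian (V : zmodType) : Prop :=
  exists E : set V, forall v : V, exists! c : V -> int,
    [/\ finite_set [set e | c e != 0],
        [set e | c e != 0] `<=` E
      & v = \sum_(e \in E) e *~ c e].

Definition pure (U V : zmodType) (f : {additive U -> V}) : Prop :=
  [/\ free_abelian U, free_abelian V & free_abelian (coker f)].

Record cochain := Cochain {
  cob :> nat -> zmodType;
  cdiff : forall n, {additive cob n -> cob n.+1};
  cdiffK : forall n x, cdiff n.+1 (cdiff n x) = 0 }.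

Section Cohomology.
Variable C : cochain.

Definition coboundary n : set (C n) :=
  match n with 0%N => [set 0] | m.+1 => range (cdiff C m) end.

Lemma coboundary_closed n :
  subgroup_closed [set z : ker (cdiff C n) | coboundary (sub_val z)].
Proof.
split=> [|x y]; rewrite /mkset ?raddf0 ?raddfB.
  by case: n => [|n] //=; exists 0; rewrite ?raddf0.
case: n x y => [|n] x y /=; first by move=> -> ->; rewrite subrr.
by move=> [u _ <-] [v _ <-]; exists (u - v); rewrite ?raddfB.
Qed.

Definition cohomology n : zmodType := quot_zmod (@coboundary_closed n).

End Cohomology.

Section Functors.
Context {disp : Order.disp_t} (P : porderType disp).

Record functor := Functor {
  fob :> P -> zmodType;
  fmap : forall p q, (p <= q)%O -> {additive fob p -> fob q};
  fmap_id : forall p (h : (p <= p)%O) x, fmap h x = x;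
  fmap_comp : forall p q r (h : (p <= q)%O) (k : (q <= r)%O) (l : (p <= r)%O) x,
    fmap k (fmap h x) = fmap l x }.

Record nat_trans (G H : functor) := NatTrans {
  ntapp :> forall p, {additive G p -> H p};
  ntapp_nat : forall p q (h : (p <= q)%O) x,
    ntapp q (fmap G h x) = fmap H h (ntapp p x) }.

Definition constZ : functor :=
  @Functor (fun=> int) (fun _ _ _ => idfun) (fun _ _ _ => erefl)
           (fun _ _ _ _ _ _ _ => erefl).

Section Limit.
Variable G : functor.

Definition compatible : set (dprod G) :=
  [set x | forall p q (h : (p <= q)%O), fmap G h (x p) = x q].

Lemma compatible_closed : subgroup_closed compatible.
Proof.
split=> [p q h|x y cx cy p q h]; first by rewrite raddf0.
by rewrite raddfB cx cy.
Qed.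

Definition lim : zmodType := sub_zmod compatible_closed.

End Limit.

Section LimMap.
Variables (G H : functor) (f : nat_trans G H).

Lemma lim_map_compatible (x : lim G) :
  @compatible H (fun p => f p (sub_val x p)).
Proof. by move=> p q h; rewrite -ntapp_nat (sub_valE x). Qed.

Definition lim_map (x : lim G) : lim H := to_sub (compatible_closed H) (lim_map_compatible x).

Lemma lim_map_is_additive : zmod_morphism lim_map.
Proof.
by move=> x y; apply/val_inj/functional_extensionality_dep => p; exact: raddfB.
Qed.

HB.instance Definition _ :=
  GRing.isZmodMorphism.Build (lim G) (lim H) lim_map lim_map_is_additive.

End LimMap.

Definition mono_trans (G H : functor) (i : nat_trans G H) : Prop :=
  forall p, injective (i p).

Definition injective_functor (I : functor) : Prop :=
  forall (G H : functor) (i : nat_trans G H) (f : nat_trans G I),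
    mono_trans i ->
    exists g : nat_trans H I, forall p x, g p (i p x) = f p x.

Record injective_resolution (M : functor) := InjectiveResolution {
  res_ob :> nat -> functor;
  res_aug : nat_trans M (res_ob 0);
  res_diff : forall n, nat_trans (res_ob n) (res_ob n.+1);
  res_inj : forall n, injective_functor (res_ob n);
  res_aug_mono : mono_trans res_aug;
  res_exact0 : forall p x, res_diff 0 p x = 0 <-> range (res_aug p) x;
  res_exactS : forall n p x,
    res_diff n.+1 p x = 0 <-> range (res_diff n p) x }.

Section DerivedLimit.
Variables (M : functor) (I : injective_resolution M).

Lemma lim_diffK n (x : lim (I n)) :
  lim_map (res_diff I n.+1) (lim_map (res_diff I n) x) = 0.
Proof.
apply/val_inj/functional_extensionality_dep => p.
have /= := proj2 (res_exactS (res_diff I n p (sub_val x p))).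
by apply; exists (sub_val x p).
Qed.

Definition lim_complex : cochain :=
  @Cochain (fun n => lim (I n)) (fun n => lim_map (res_diff I n)) lim_diffK.

(* lim^n M; independent of the resolution I up to isomorphism. *)
Definition derived_lim n : zmodType := cohomology lim_complex n.

End DerivedLimit.

Definition prod_on (G : functor) (A : set P) : zmodType :=
  dprod (fun p : A => G (\val p)).

Section ProdOn.
Variable G : functor.

Definition restrict (A B : set P) (BA : B `<=` A) (x : prod_on G A) : prod_on G B :=
  fun p => x (exist _ (\val p) (mem_set (BA _ (set_mem (valP p))))).

Lemma restrict_is_additive A B BA : zmod_morphism (@restrict A B BA).
Proof. by []. Qed.

HB.instance Definition _ A B BA :=
  GRing.isZmodMorphism.Build (prod_on G A) (prod_on G B) (@restrict A B BA)
    (@restrict_is_additive A B BA).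

Definition extend0 (A B : set P) (x : prod_on G A) : prod_on G B :=
  fun p => match pselect (A (\val p)) with
           | left Ap => x (exist _ (\val p) (mem_set Ap))
           | right _ => 0
           end.

Lemma extend0_is_additive A B : zmod_morphism (@extend0 A B).
Proof.
move=> x y; apply: functional_extensionality_dep => p; rewrite /extend0 /=.
by rewrite [RHS]/GRing.add /= /GRing.opp /=; case: pselect => //= _; rewrite subr0.
Qed.

HB.instance Definition _ A B :=
  GRing.isZmodMorphism.Build (prod_on G A) (prod_on G B) (@extend0 A B)
    (@extend0_is_additive A B).

Definition lim_restrict (A : set P) (x : lim G) : prod_on G A :=
  fun p => sub_val x (\val p).

End ProdOn.

Definition precedes (p q : P) : Prop :=
  (p < q)%O /\ forall r : P, (p <= r)%O -> (r <= q)%O -> r = p \/ r = q.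

Record graded (deg : P -> nat) : Prop := Graded {
  deg_rev : forall p q, (p <= q)%O -> (deg q <= deg p)%N;
  deg_precedes : forall p q, precedes p q -> deg p = (deg q).+1;
  up_finite : forall p0, finite_set [set p : P | (p0 <= p)%O] }.

Definition connected (A : set P) : Prop :=
  A !=set0 /\ forall x y, A x -> A y ->
    exists s : seq P,
      [/\ forall z, z \in s -> A z, path (fun u v => (u >=< v)%O) x s & last x s = y].

Variable deg : P -> nat.

Definition Ob n : set P := [set p | deg p = n].
Definition up p0 n : set P := [set p | (p0 <= p)%O /\ deg p = n].
Definition upper p0 : set P := [set p | (p0 < p)%O].

Fixpoint Rnum (n : nat) (p0 : P) : int :=
  if n is m.+1 then (\sum_(p \in up p0 m) Rnum m p) - Rnum m p0 else 1.

Record local_covering (J : P -> nat -> set P) : Prop := LocalCovering {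
  lc_sub : forall p0 n, (n <= deg p0)%N -> J p0 n `<=` up p0 n;
  lc_cover : forall p0 n, (n < deg p0)%N ->
    \bigcup_(p in J p0 n.+1) up p n = up p0 n;
  lc_mono : forall p0 n p, (n < deg p0)%N -> J p0 n.+1 p -> J p n `<=` J p0 n }.

Record adequate (J : P -> nat -> set P) : Prop := Adequate {
  adequate_conn : forall p0, (2 <= deg p0)%N -> connected (upper p0);
  adequate_R : forall n p0, (n.+1 <= deg p0)%N ->
    Rnum n p0 = \sum_(p \in J p0 n) Rnum n p }.

Section NextFunctor.
Variables (G : functor) (n : nat).

Definition to_up p0 (x : G p0) : prod_on G (up p0 n) :=
  fun p => fmap G (set_mem (valP p)).1 x.

Lemma to_up_is_additive p0 : zmod_morphism (@to_up p0).
Proof.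
by move=> x y; apply: functional_extensionality_dep => p; exact: raddfB.
Qed.

HB.instance Definition _ p0 :=
  GRing.isZmodMorphism.Build (G p0) (prod_on G (up p0 n)) (@to_up p0)
    (@to_up_is_additive p0).

Lemma up_sub p q : (p <= q)%O -> up q n `<=` up p n.
Proof. by move=> pq r [qr dr]; split=> //; exact: le_trans qr. Qed.

Lemma next_map_im p q (h : (p <= q)%O) x :
  range (@to_up p) x -> range (@to_up q) (restrict (up_sub h) x).
Proof.
move=> [y _ <-]; exists (fmap G h y) => //.
by apply: functional_extensionality_dep => r; exact: fmap_comp.
Qed.

Definition next_map p q (h : (p <= q)%O) :
    {additive coker (@to_up p) -> coker (@to_up q)} :=
  coker_map (next_map_im h).

Lemma next_map_id p (h : (p <= p)%O) x : next_map h x = x.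
Proof.
rewrite -[x]quot_reprK /= coker_mapE; congr (quot_class _ _).
apply: functional_extensionality_dep => -[r hr].
rewrite /= /restrict; move: (mem_set _) => /= hr'.
by rewrite (bool_irrelevance hr' hr).
Qed.

Lemma next_map_comp p q r (h : (p <= q)%O) (k : (q <= r)%O) (l : (p <= r)%O) x :
  next_map k (next_map h x) = next_map l x.
Proof.
rewrite -[x]quot_reprK /= !coker_mapE; congr (quot_class _ _).
apply: functional_extensionality_dep => s.
rewrite /= /restrict; move: (mem_set (up_sub h _)) (mem_set (up_sub l _)) => /= h1 h2.
by rewrite quot_reprK (bool_irrelevance h1 h2).
Qed.

Definition next_functor : functor :=
  @Functor (fun p0 => coker (@to_up p0)) next_map next_map_id next_map_comp.

End NextFunctor.

Fixpoint F (n : nat) : functor :=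
  if n is m.+1 then next_functor (F m) m else constZ.

Lemma up_Ob q n : up q n `<=` Ob n.
Proof. by move=> p []. Qed.

Definition dF n (x : prod_on (F n) (Ob n)) : prod_on (F n.+1) (Ob n.+1) :=
  fun q => quot_class (im_closed (@to_up (F n) n (\val q))) (restrict (@up_Ob (\val q) n) x).

Lemma dF_is_additive n : zmod_morphism (@dF n).
Proof.
move=> x y; apply: functional_extensionality_dep => q.
by rewrite /dF !raddfB.
Qed.

HB.instance Definition _ n :=
  GRing.isZmodMorphism.Build (prod_on (F n) (Ob n)) (prod_on (F n.+1) (Ob n.+1))
    (@dF n) (@dF_is_additive n).

Section Global.
Variables (K : nat -> set P) (KOb : forall n, K n `<=` Ob n).

Definition omega n : {additive prod_on (F n) (Ob n `\` K n)
                             -> prod_on (F n.+1) (K n.+1)} :=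
  restrict (KOb (n := n.+1)) \o @dF n \o extend0 (B := Ob n).

End Global.

Definition global_covering (K : nat -> set P) : Prop :=
  exists KOb : forall n, K n `<=` Ob n,
    (forall n, injective (@lim_restrict (F n) (K n))) /\
    (forall n, pure (omega KOb n)).

Definition betti (K : nat -> set P) (n : nat) : int :=
  if n is m.+1 then
    (\sum_(p \in K m) Rnum m p) - (\sum_(p \in Ob m) Rnum m p)
      + (\sum_(p \in K m.+1) Rnum m.+1 p)
  else \sum_(p \in K 0%N) Rnum 0 p.

(* The Betti numbers are integers only if the sums defining them are finite;
   \sum_(p \in A) is 0 by convention when its support is infinite. *)
Definition betti_sums_finite : Prop :=
  forall n, finite_set [set p | Ob n p /\ Rnum n p != 0].

End Functors.

(* Main.v *)
(* F_{n+1} is the cokernel of F_n -> F'_n, where F'_n(p) is the product of F_n over the degree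
   n objects above p. The adequate local covering family makes F_n(p) free of rank R_n^p and
   F_n -> F'_n injective: each class in F_{n+1}(p) has a unique representative vanishing on
   J_n^p, so F_{n+1}(p) injects into the product of F_{n+1} over J_{n+1}^p with torsion-free
   cokernel, and the ranks agree. Hence F'_0 -> F'_1 -> ... is a resolution of c_Z, by flabby
   functors (every section over {q | p < q} extends to p). Taking sections preserves exactness
   of complexes of flabby functors; applied to the cone of a comparison map into an injective
   resolution, this shows that the complex C^n = prod_{Ob_n} F_n computes the derived limits.
   Finally C is divided by the acyclic subcomplex U_n + d U_{n-1}, where U_n consists of the
   families vanishing on K_n. The quotient in degree n is coker omega_{n-1}, and omega_{n-1} is
   injective with free cokernel. *)
From HB Require Import structures.
From mathcomp Require Import all_boot all_order all_algebra ring_quotient.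
From mathcomp Require Import boolp classical_sets functions cardinality fsbigop.
Require Import Defs.

Set Implicit Arguments.
Unset Strict Implicit.
Unset Printing Implicit Defensive.

Import Order.TTheory GRing.Theory Num.Theory.

Local Open Scope classical_set_scope.
Local Open Scope ring_scope.

(** * Free abelian groups of finite rank *)

Lemma additive_of (U V : zmodType) (f : U -> V) :
  zmod_morphism f -> exists g : {additive U -> V}, g =1 f.
Proof.
move=> fB; pose fM := GRing.isZmodMorphism.Build U V f fB.
by exists (HB.pack_for {additive U -> V} f fM).
Qed.

Lemma additive_inj (U V : zmodType) (f : {additive U -> V}) :
  (forall x, f x = 0 -> x = 0) -> injective f.
Proof.
move=> f0 x y fxy; apply/eqP; rewrite -subr_eq0; apply/eqP/f0.
by rewrite raddfB fxy subrr.
Qed.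

Lemma isomorphic_of (U V : zmodType) (f : {additive U -> V}) :
  (forall x, f x = 0 -> x = 0) -> (forall y, exists x, f x = y) ->
  isomorphic U V.
Proof.
move=> f0 fS; exists f.
have [g fg] := choice fS.
exists g => // x; apply: (additive_inj f0); exact: fg.
Qed.

Lemma isomorphicP (U V : zmodType) : isomorphic U V ->
  exists (f : {additive U -> V}) (g : {additive V -> U}), cancel f g /\ cancel g f.
Proof.
move=> [f [g fg gf]].
have [g' g'E] := additive_of (can2_zmod_morphism fg gf).
by exists f, g'; split=> x; rewrite g'E.
Qed.

Lemma isomorphic_sym (U V : zmodType) : isomorphic U V -> isomorphic V U.
Proof. by move=> /isomorphicP[f [g [fg gf]]]; exists g; exists f. Qed.

Lemma isomorphic_trans (U V W : zmodType) :
  isomorphic U V -> isomorphic V W -> isomorphic U W.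
Proof.
move=> [f fb] [g gb]; exists (g \o f : {additive _ -> _}).
exact: bij_comp gb fb.
Qed.

Lemma quot_isomorphic (V W : zmodType) (A : set V) (cA : subgroup_closed A)
    (g : {additive V -> W}) :
  (forall y, exists x, g x = y) -> (forall x, g x = 0 <-> A x) ->
  isomorphic (quot_zmod cA) W.
Proof.
move=> gS gA.
have qB : zmod_morphism (fun x : quot_zmod cA => g (quot_repr x)).
  move=> x y; apply/eqP; rewrite -subr_eq0 -raddfB -raddfB; apply/eqP/gA.
  by apply/(quot_class_eq0 cA); rewrite !raddfB /= !quot_reprK -opprD subrr.
have [q qE] := additive_of qB.
apply: (@isomorphic_of _ _ q) => [x|y].
  by rewrite qE => /gA /(quot_class_eq0 cA); rewrite quot_reprK.
have [x <-] := gS y; exists (quot_class cA x); rewrite qE.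
apply/eqP; rewrite -subr_eq0 -raddfB; apply/eqP/gA.
by apply/(quot_class_eq0 cA); rewrite raddfB /= quot_reprK subrr.
Qed.

Lemma coker_isomorphic (U V W : zmodType) (f : {additive U -> V})
    (g : {additive V -> W}) :
  (forall y, exists x, g x = y) -> (forall x, g x = 0 <-> range f x) ->
  isomorphic (coker f) W.
Proof. exact: quot_isomorphic. Qed.

(** The rank is an integer because [Rnum] and [betti] involve subtractions; the sign condition keeps
    the absolute value from hiding a negative number. *)
Definition zfree (V : zmodType) (r : int) :=
  0 <= r /\ isomorphic V 'rV[int]_`|r|.

Lemma isomorphic_zfree (U V : zmodType) r :
  isomorphic U V -> zfree V r -> zfree U r.
Proof. by move=> UV [r0 VZ]; split=> //; exact: isomorphic_trans VZ. Qed.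

Lemma zfree_trivial (V : zmodType) : (forall x : V, x = 0) -> zfree V 0.
Proof.
move=> V0; split=> //; apply: (@isomorphic_of _ _ (\0 : {additive _ -> _})) => // y.
by exists 0; apply/rowP => -[].
Qed.

Lemma zfree0_eq0 (V : zmodType) (x : V) : zfree V 0 -> x = 0.
Proof.
case=> _ [f /bij_inj f_inj]; apply: f_inj; apply/rowP => -[].
by [].
Qed.

Lemma zfree_int : zfree int 1.
Proof.
have sB : zmod_morphism (fun x : int => x%:M : 'rV[int]_1) by exact: raddfB.
have [s sE] := additive_of sB; split=> //; apply: (@isomorphic_of _ _ s) => [x|y].
  by rewrite sE => /rowP/(_ 0); rewrite !mxE eqxx mulr1n.
by exists (y 0 0); rewrite sE -mx11_scalar.
Qed.

Lemma mulrz_row n (x : 'rV[int]_n) (m : int) : x *~ m = m *: x.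
Proof. by rewrite -scaler_int intz. Qed.

Lemma zfree_torsionfree (V : zmodType) r (x : V) (m : int) :
  zfree V r -> m != 0 -> x *~ m = 0 -> x = 0.
Proof.
case=> _ [f /bij_inj f_inj] m0 xm; apply: f_inj.
rewrite raddf0; apply/rowP => i; have := congr1 f xm.
rewrite raddfMz raddf0 mulrz_row => /rowP/(_ i)/eqP.
by rewrite !mxE mulf_eq0 (negPf m0) => /eqP.
Qed.

Lemma zfree_pair (U V : zmodType) (r s : int) :
  zfree U r -> zfree V s -> zfree (U * V)%type (r + s).
Proof.
have absD (i j : int) : 0 <= i -> 0 <= j -> absz (i + j) = (absz i + absz j)%N.
  by case: i j => [i|i] [j|j].
move=> [r0 /isomorphicP[f [f' [fK f'K]]]] [s0 /isomorphicP[g [g' [gK g'K]]]].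
split; first exact: addr_ge0.
rewrite (absD _ _ r0 s0).
have hB : zmod_morphism (fun x : U * V => row_mx (f x.1) (g x.2)).
  by move=> x y; rewrite !raddfB /= opp_row_mx add_row_mx.
have [h hE] := additive_of hB; apply: (@isomorphic_of _ _ h) => [[x y]|z].
  rewrite hE /= -row_mx0 => /eq_row_mx[fx gy].
  by rewrite -[x]fK -[y]gK fx gy !raddf0.
exists (f' (lsubmx z), g' (rsubmx z)).
by rewrite hE /= f'K g'K hsubmxK.
Qed.

Lemma additive_row_mx m n (f : {additive 'rV[int]_m -> 'rV[int]_n}) :
  exists M : 'M_(m, n), forall x, f x = x *m M.
Proof.
exists (\matrix_i f (delta_mx 0 i)) => x.
rewrite mulmx_sum_row {1}[x]row_sum_delta raddf_sum; apply: eq_bigr => i _.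
by rewrite -!mulrz_row raddfMz rowK.
Qed.

(* Smith normal form: an injective matrix with torsion-free cokernel is equivalent to [1 | 0]. *)
Lemma row_mx_coker m n (M : 'M[int]_(m, n)) :
  (forall x : 'rV_m, x *m M = 0 -> x = 0) ->
  (forall (y : 'rV_n) k, k != 0 -> (exists x : 'rV_m, x *m M = y *~ k) ->
    exists x : 'rV_m, x *m M = y) ->
  exists d (g : {additive 'rV[int]_n -> 'rV[int]_d}),
    [/\ n = (m + d)%N, forall y, exists x, g x = y
      & forall y, g y = 0 <-> exists x : 'rV_m, x *m M = y].
Proof.
move=> Minj Mpure.
have [L Lu [R Ru [d _ dM]]] := int_Smith_normal_form M.
set D := \matrix_(i, j) _ in dM.
have DE i j : D i j = d`_i *+ (i == j :> nat) by rewrite mxE.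
move: D dM DE => D dM DE.
have LD (x : 'rV_m) : x *m L *m D = x *m M *m invmx R.
  by rewrite dM !mulmxA mulmxK.
have Dinj (x : 'rV_m) : x *m D = 0 -> x = 0.
  rewrite -{1}[x](mulmxKV Lu) LD => /(congr1 (fun z => z *m R)).
  rewrite mul0mx mulmxKV // => /Minj /(congr1 (fun z => z *m L)).
  by rewrite mul0mx mulmxKV.
have Dpure (y : 'rV_n) k : k != 0 -> (exists x : 'rV_m, x *m D = y *~ k) ->
    exists x : 'rV_m, x *m D = y.
  move=> k0 [x xD]; have [|z zM] := Mpure (y *m R) k k0.
    by exists (x *m invmx L); rewrite -[_ *m M](mulmxKV Ru) -LD mulmxKV // xD !mulrz_row -scalemxAl.
  by exists (z *m L); rewrite LD zM mulmxK.
(* If [n < m], row [n] of the diagonal matrix [D] is zero, which contradicts injectivity. *)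
have le_mn : (m <= n)%N.
  rewrite leqNgt; apply/negP => lt_nm.
  have /Dinj /rowP/(_ (Ordinal lt_nm)) : (delta_mx 0 (Ordinal lt_nm) : 'rV_m) *m D = 0.
    by rewrite -rowE; apply/rowP => j; rewrite !mxE DE eqn_leq /= leqNgt ltn_ord.
  by rewrite !mxE !eqxx.
move: le_mn => /subnKC; move: (n - m)%N => k nE.
move: {Minj Mpure} M R Ru D dM DE LD Dinj Dpure; case: _ / nE => M R Ru D dM DE LD Dinj Dpure.
have D_l (x : 'rV_m) (i : 'I_m) : (x *m D) 0 (lshift k i) = x 0 i * d`_i.
  rewrite !mxE (bigD1 i) //= DE eqxx big1 ?addr0 // => j ji.
  by rewrite DE /= (inj_eq val_inj) (negPf ji) mulr0.
have D_r (x : 'rV_m) (i : 'I_k) : (x *m D) 0 (rshift m i) = 0.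
  rewrite !mxE big1 // => j _; rewrite DE /= ltn_eqF ?mulr0 //.
  exact: ltn_addr.
have d0 (i : 'I_m) : d`_i != 0.
  apply/eqP => di; have /Dinj /rowP/(_ i) : (delta_mx 0 i : 'rV_m) *m D = 0.
    apply/rowP => j; case: (split_ordP j) => j' ->; rewrite ?D_r ?D_l mxE //.
    by rewrite !mxE /=; case: eqP => [->|]; rewrite ?di ?mulr0 ?mul0r.
  by rewrite !mxE !eqxx.
(* The image contains [d_i] times a unit vector, so by purity it contains the unit vector itself,
   and [d_i] divides 1. *)
have d1 (i : 'I_m) : exists e, e * d`_i = 1.
  have [|x /rowP/(_ (lshift k i))] := Dpure (delta_mx 0 (lshift k i)) _ (d0 i).
    exists (delta_mx 0 i); apply/rowP => j; rewrite mulrz_row.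
    case: (split_ordP j) => j' ->; rewrite ?D_r ?D_l !mxE !eqxx /= ?mulr0 //.
      by rewrite (inj_eq (@lshift_inj _ _)) mulrC; case: eqP => [->|]; rewrite ?mulr0.
    by rewrite eq_sym eq_lrshift mulr0.
  by rewrite D_l !mxE !eqxx; exists (x 0 i).
have [e eE] := choice d1.
have gB : zmod_morphism (fun y : 'rV[int]_(m + k) => rsubmx (y *m invmx R)).
  by move=> x y; rewrite mulmxBl raddfB.
have [g gE] := additive_of gB; exists k, g; split=> // [y|y].
  by exists (row_mx 0 y *m R); rewrite gE mulmxK // row_mxKr.
rewrite gE; split=> [y0|[x <-]]; last first.
  apply/rowP => i; rewrite -[x](mulmxKV Lu) -LD.
  by rewrite [LHS]mxE D_r !mxE.
pose x := \row_i (lsubmx (y *m invmx R) 0 i * e i).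
exists (x *m invmx L); rewrite -[_ *m M](mulmxKV Ru) -LD mulmxKV //.
rewrite -[RHS](mulmxKV Ru); congr (_ *m R); apply/rowP => j.
case: (split_ordP j) => j' ->; rewrite ?D_r ?D_l.
  by rewrite !mxE -mulrA eE mulr1.
by move/rowP/(_ j'): y0; rewrite !mxE.
Qed.

(** The last hypothesis says that the cokernel is torsion-free. In coordinates [row_mx_coker]
    applies, and its equation [n = m + d] gives the rank. *)
Lemma zfree_coker (U V : zmodType) (f : {additive U -> V}) (r s : int) :
  zfree U r -> zfree V s -> (forall x, f x = 0 -> x = 0) ->
  (forall v k, k != 0 -> range f (v *~ k) -> range f v) ->
  zfree (coker f) (s - r).
Proof.
move=> [r0 /isomorphicP[a [a' [aK a'K]]]] [s0 /isomorphicP[b [b' [bK b'K]]]] fI fP.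
have [M ME] := additive_row_mx (b \o f \o a' : {additive _ -> _}).
have {}ME x : b (f (a' x)) = x *m M by rewrite -ME.
have rangeM v : range f v <-> exists x, x *m M = b v.
  split=> [[u _ <-]|[x xM]]; first by exists (a u); rewrite -ME aK.
  by exists (a' x) => //; rewrite -[LHS]bK ME xM bK.
have [||d [g [sE gS gM]]] := @row_mx_coker _ _ M.
- move=> x; rewrite -ME => /(congr1 b'); rewrite bK raddf0 => /fI.
  by move=> /(congr1 a); rewrite a'K raddf0.
- move=> y k k0 [x xM].
  have /rangeM : range f (b' y); last by rewrite b'K.
  apply: (fP _ k k0); apply/rangeM; exists x.
  by rewrite raddfMz /= b'K.
have -> : s - r = d.
  by rewrite -(gez0_abs r0) -(gez0_abs s0) sE PoszD addrAC subrr add0r.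
split=> //; apply: (@coker_isomorphic _ _ _ f (g \o b : {additive _ -> _})) => [y|v].
  by have [x <-] := gS y; exists (b' x); rewrite /= b'K.
by rewrite rangeM -gM.
Qed.

(** The cokernel is free of rank [r - r = 0]. Through this lemma the equality of ranks in adequacy
    becomes surjectivity. *)
Lemma zfree_inj_surj (U V : zmodType) (f : {additive U -> V}) (r : int) :
  zfree U r -> zfree V r -> (forall x, f x = 0 -> x = 0) ->
  (forall v k, k != 0 -> range f (v *~ k) -> range f v) ->
  forall v, range f v.
Proof.
move=> Ur Vr fI fP v; have := zfree_coker Ur Vr fI fP; rewrite subrr => c0.
exact/(quot_class_eq0 (im_closed f))/zfree0_eq0.
Qed.

(** Multiplying the coefficients of [v] by [k] gives an expansion of [v *~ k = 0], so uniqueness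
    makes them all vanish. Purity of [omega] enters in this form. *)
Lemma free_abelian_torsionfree (V : zmodType) (v : V) (k : int) :
  free_abelian V -> k != 0 -> v *~ k = 0 -> v = 0.
Proof.
move=> [E EV] k0 vk.
have [c [[cf cE cv] _]] := EV v; have [c' [_ c'U]] := EV 0.
have z0 : c' = fun=> 0.
  apply: c'U; split; [|by move=> x|by rewrite fsbig1].
  by rewrite (_ : [set _ | _] = set0) //; apply/seteqP; split=> x.
have supp : [set e | c e * k != 0] = [set e | c e != 0].
  by apply/seteqP; split=> e /=; rewrite mulf_eq0 (negPf k0) orbF.
(* Sums over the possibly infinite basis are cut down to the finite support of [c], where
   multiplication by [k] distributes. *)
have cW h : [set e | h e != 0] = [set e | c e != 0] ->
    \sum_(e \in E) e *~ h e = \sum_(e \in [set e | c e != 0]) e *~ h e.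
  move=> hc; apply/esym/fsbig_widen => // e [_ /=].
  have [->|he ce] := eqVneq (h e) 0; first by rewrite mulr0z.
  by case: ce; have : [set e | h e != 0] e by []; rewrite hc.
have kc : c' = fun e => c e * k.
  apply: c'U; rewrite supp; split=> //.
  rewrite cW // -[LHS]vk {1}cv cW // !fsbig_finite // mulrz_suml.
  by apply: eq_bigr => e _; rewrite mulrzA.
rewrite cv fsbig1 // => e _.
have /eqP : c e * k = 0 by rewrite -[LHS](congr1 (@^~ e) kc) z0.
by rewrite mulf_eq0 (negPf k0) orbF => /eqP->; rewrite mulr0z.
Qed.

(** * Products over sets of objects *)

Section ProdOnTheory.
Context {disp : Order.disp_t} {P : porderType disp}.
Implicit Types (G : functor P) (A B : set P).

(** Indices of [prod_on] carry boolean membership proofs; [prod_at] and [prod_mk] exchange them for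
    proofs of [A p]. *)
Definition prod_at G A (x : prod_on G A) p (Ap : A p) : G p :=
  x (exist _ p (mem_set Ap)).

Definition prod_mk G A (f : forall p, A p -> G p) : prod_on G A :=
  fun p => f (\val p) (set_mem (valP p)).

Lemma prod_ext G A (x y : prod_on G A) :
  (forall p (Ap : A p), prod_at x Ap = prod_at y Ap) -> x = y.
Proof.
move=> xy; apply: functional_extensionality_dep => -[p pA].
by move: (xy p (set_mem pA)); rewrite /prod_at (bool_irrelevance (mem_set _) pA).
Qed.

Lemma prod_mkE G A (f : forall p, A p -> G p) p (Ap : A p) :
  prod_at (prod_mk f) Ap = f p Ap.
Proof. by congr (f p _); exact: Prop_irrelevance. Qed.

Lemma prod_atB G A (x y : prod_on G A) p (Ap : A p) :
  prod_at (x - y) Ap = prod_at x Ap - prod_at y Ap.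
Proof. by []. Qed.

Lemma prod_at_additive G A p (Ap : A p) :
  exists f : {additive prod_on G A -> G p}, forall x, f x = prod_at x Ap.
Proof. by apply: additive_of => x y; exact: prod_atB. Qed.

Lemma prod_atMz G A (x : prod_on G A) k p (Ap : A p) :
  prod_at (x *~ k) Ap = prod_at x Ap *~ k.
Proof.
by have [f fE] := prod_at_additive G Ap; rewrite -!fE raddfMz.
Qed.

Lemma restrict_at G A B (BA : B `<=` A) (x : prod_on G A) p (Bp : B p) (Ap : A p) :
  prod_at (restrict BA x) Bp = prod_at x Ap.
Proof. by rewrite /prod_at /restrict /=; congr (x (exist _ p _)); exact: bool_irrelevance. Qed.

Lemma extend0_at G A B (x : prod_on G A) p (Ap : A p) (Bp : B p) :
  prod_at (extend0 (B := B) x) Bp = prod_at x Ap.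
Proof.
rewrite /prod_at /extend0; case: pselect => //= Ap'.
by congr (x (exist _ p _)); exact: bool_irrelevance.
Qed.

Lemma extend0_out G A B (x : prod_on G A) p (Bp : B p) :
  ~ A p -> prod_at (extend0 (B := B) x) Bp = 0.
Proof. by rewrite /prod_at /extend0; case: pselect. Qed.

Lemma fmap_irr G p q (h h' : (p <= q)%O) x : fmap G h x = fmap G h' x.
Proof. by rewrite (bool_irrelevance h h'). Qed.

(** Induction on [s] splits off one factor at a time. Factors outside [s] have rank 0 and are
    trivial, so [A] may be infinite. *)
Lemma zfree_prod_on_seq G (r : P -> int) (s : seq P) A :
  uniq s -> [set` s] `<=` A -> (forall p, A p -> zfree (G p) (r p)) ->
  (forall p, A p -> p \notin s -> r p = 0) ->
  zfree (prod_on G A) (\sum_(p <- s) r p).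
Proof.
elim: s A => [|p s IHs] A /=.
  move=> _ _ Gr r0; rewrite big_nil; apply: zfree_trivial => x; apply: prod_ext => p Ap.
  by apply: zfree0_eq0; rewrite -(r0 p Ap) //; exact: Gr.
move=> /andP[ps us] sA Gr r0; rewrite big_cons.
have Ap : A p by apply: sA; rewrite /= mem_head.
have sub : A `\ p `<=` A by move=> q [].
have {IHs} IH : zfree (prod_on G (A `\ p)) (\sum_(q <- s) r q).
  apply: IHs => // [q /= qs|q [Aq _]|q [Aq /eqP qp] qs]; last 2 first.
  - exact: Gr.
  - by apply: r0; rewrite // inE negb_or qp.
  split; first by apply: sA; rewrite /= inE qs orbT.
  by move=> /= qp; rewrite -qp qs in ps.
apply: isomorphic_zfree (zfree_pair (Gr p Ap) IH).
have fB : zmod_morphism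
    (fun x : prod_on G A => (prod_at x Ap, restrict sub x) : (G p * prod_on G (A `\ p))%type).
  by move=> x y; rewrite raddfB.
have [f fE] := additive_of fB; apply: (@isomorphic_of _ _ f) => [x|[g y]].
  rewrite fE => -[xp xA]; apply: prod_ext => q Aq.
  have [qp|/eqP qp] := eqVneq q p.
    by move: Aq; rewrite qp => Aq; rewrite (Prop_irrelevance Aq Ap).
  have Aq' : (A `\ p) q by [].
  by rewrite -(restrict_at sub x Aq' Aq) xA.
(* The family with value [g] at [p] and [y] elsewhere; [g] has to be transported along [q = p] to
   the type [G q]. *)
pose x := prod_mk (fun q (Aq : A q) => match pselect (q = p) with
  | left e => eq_rect p (fun q => G q : Type) g q (esym e)
  | right ne => prod_at (A := A `\ p) y (conj Aq ne) end).
exists x; rewrite fE; congr pair.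
  rewrite prod_mkE; case: pselect => // e.
  by rewrite (Prop_irrelevance e erefl).
apply: prod_ext => q [Aq qp]; rewrite (restrict_at _ _ _ Aq) prod_mkE.
case: pselect => // qp'; congr prod_at; exact: Prop_irrelevance.
Qed.

Lemma zfree_prod_on G A (r : P -> int) :
  (forall p, A p -> zfree (G p) (r p)) ->
  finite_set [set p | A p /\ r p != 0] ->
  zfree (prod_on G A) (\sum_(p \in A) r p).
Proof.
move=> Gr fin.
set s := finmap.enum_fset (fset_set [set p | A p /\ r p != 0]).
have sE p : (p \in s) = (p \in [set p | A p /\ r p != 0]) by exact: in_fset_set.
have sA : [set` s] `<=` A by move=> p /=; rewrite sE => /set_mem[].
have s0 p : A p -> p \notin s -> r p = 0.
  move=> Ap; rewrite sE => ps; apply: contrapT => /eqP rp.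
  by move/negP: ps; apply; apply/mem_set.
rewrite (@fsbigE _ _ _ _ A s) ?finmap.fset_uniq // -big_filter.
rewrite (_ : [seq _ <- s | _] = s).
  exact: zfree_prod_on_seq (finmap.fset_uniq _) _ _ _.
by apply/all_filterP/allP => p /= /sA /mem_set.
Qed.

End ProdOnTheory.

(** * The functors F_n and local covering families *)

Lemma seq_minimal {disp : Order.disp_t} {P : porderType disp} (a : P) (s : seq P) :
  exists2 m, m \in a :: s & forall x, x \in a :: s -> ~ (x < m)%O.
Proof.
elim: s a => [|b s IHs] a.
  by exists a => [|x]; rewrite ?mem_head // inE => /eqP->; rewrite ltxx.
have [m ms mP] := IHs b; have [am|am] := boolP (a < m)%O.
  exists a => [|x]; first exact: mem_head.
  rewrite inE => /predU1P[->|xs xa]; first by rewrite ltxx.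
  exact: mP xs (lt_trans xa am).
exists m => [|x]; first by rewrite inE ms orbT.
by rewrite inE => /predU1P[->|/mP//]; apply/negP.
Qed.

Section Graded.
Context {disp : Order.disp_t} {P : porderType disp} (deg : P -> nat).
Hypothesis hdeg : graded deg.

(** The grading controls degrees only along covering relations. A minimal element [m] of the finite
    interval between [p] (excluded) and [q] is preceded by [p], whence
    [deg p = deg m + 1 > deg q]. *)
Lemma deg_lt p q : (p < q)%O -> (deg q < deg p)%N.
Proof.
move=> pq; have Sfin : finite_set [set r | (p < r)%O /\ (r <= q)%O].
  apply: sub_finite_set (up_finite hdeg p) => r [pr _]; exact: ltW.
have [s sE] := (finite_seqP _).1 Sfin.
have sP r : (r \in s) = (p < r)%O && (r <= q)%O.
  apply/idP/andP => rS; first by have : [set` s] r by []; rewrite -sE.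
  by suff : [set` s] r by []; rewrite -sE.
have : q \in s by rewrite sP pq /=.
case: s {sE} sP => // a s sP _.
have [m ms mP] := seq_minimal a s.
move: (ms); rewrite sP => /andP[pm mq].
suff -> : deg p = (deg m).+1 by rewrite ltnS; apply: (deg_rev hdeg).
apply: (deg_precedes hdeg); split=> // r pr rm.
have [->|rp] := eqVneq r p; [by left|right].
apply/eqP; move: rm; rewrite le_eqVlt => /orP[//|rm].
case: (mP r) => //; rewrite sP lt_neqAle eq_sym rp pr /=.
exact: le_trans (ltW rm) mq.
Qed.

Lemma up_deg p q n : up deg p n q -> deg p = n -> q = p.
Proof.
move=> [pq dq] dp; apply/eqP; move: pq; rewrite le_eqVlt eq_sym => /orP[//|/deg_lt].
by rewrite dq dp ltnn.
Qed.

Local Notation F := (F deg).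
Local Notation R := (Rnum deg).
Local Notation up := (up deg).

Definition toF n p (z : prod_on (F n) (up p n)) : F n.+1 p :=
  quot_class (im_closed (@to_up _ _ deg (F n) n p)) z.

Lemma toF_surj n p (c : F n.+1 p) : exists z, toF z = c.
Proof. by exists (quot_repr c); exact: quot_reprK. Qed.

Lemma toF_eq0 n p (z : prod_on (F n) (up p n)) :
  toF z = 0 <-> exists x, to_up x = z.
Proof.
rewrite /toF quot_class_eq0; split=> [[x _ <-]|[x <-]]; by exists x.
Qed.

Lemma toFB n p : zmod_morphism (@toF n p).
Proof. by move=> x y; rewrite /toF raddfB. Qed.

Lemma toF_eqP n p (z z' : prod_on (F n) (up p n)) :
  toF z = toF z' <-> exists x, to_up x = z - z'.
Proof.
rewrite -toF_eq0 toFB; split=> [->|/eqP]; first by rewrite subrr.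
by rewrite subr_eq0 => /eqP.
Qed.

Lemma toF_fmap n p q (h : (p <= q)%O) (z : prod_on (F n) (up p n)) :
  fmap (F n.+1) h (toF z) = toF (restrict (@up_sub _ _ deg n p q h) z).
Proof. exact: coker_mapE. Qed.

Lemma to_up_at n m p (x : F n p) q (Uq : up p m q) (h : (p <= q)%O) :
  prod_at (to_up (deg := deg) (n := m) x) Uq = fmap (F n) h x.
Proof. exact: fmap_irr. Qed.

(** With [n = m + 1]: if [deg p = m], the only object of degree [m] above [p] is [p], so [to_up] is
    onto; if [deg p < m], the product is empty. *)
Lemma F_trivial n p (x : F n p) : (deg p < n)%N -> x = 0.
Proof.
case: n x => [//|n] x; rewrite ltnS leq_eqVlt => dp.
have [z <-] := toF_surj x; apply/toF_eq0; case/orP: dp => [/eqP dp|dp].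
  exists (prod_at z (conj (lexx p) dp)); apply: prod_ext => q Uq.
  have qp := up_deg Uq dp; case: _ / (esym qp) Uq => Uq.
  rewrite (to_up_at _ _ (lexx p)) fmap_id; congr prod_at; exact: Prop_irrelevance.
exists 0; apply: prod_ext => q Uq; have [pq dq] := Uq.
by have := deg_rev hdeg pq; rewrite dq leqNgt dp.
Qed.

Section Adequate.
Variable J : P -> nat -> set P.
Hypotheses (hJ : local_covering deg J) (aJ : adequate deg J).

(** [J_inj], [J_surj] and [J_pure] concern the map from $F_n(p)$ to the product of $F_n$ over
    $J^p_n$: injectivity, surjectivity, and torsion-freeness of the cokernel. *)
Definition J_inj n p := forall x : F n p,
  (forall q (h : (p <= q)%O), J p n q -> fmap (F n) h x = 0) -> x = 0.

Definition J_surj n p := forall y : prod_on (F n) (J p n),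
  exists x : F n p, forall q (h : (p <= q)%O) (Jq : J p n q),
    fmap (F n) h x = prod_at y Jq.

Definition J_pure n p := forall (y : prod_on (F n) (J p n)) (k : int), k != 0 ->
  (exists x : F n p, forall q (h : (p <= q)%O) (Jq : J p n q),
    fmap (F n) h x = prod_at y Jq *~ k) ->
  exists x : F n p, forall q (h : (p <= q)%O) (Jq : J p n q),
    fmap (F n) h x = prod_at y Jq.

Definition F_zfree n := forall p, (n <= deg p)%N -> zfree (F n p) (R n p).

Lemma up_fin p n : finite_set (up p n).
Proof. by apply: sub_finite_set (up_finite hdeg p) => q []. Qed.

Lemma zfree_prod_sub n p A : F_zfree n -> A `<=` up p n ->
  zfree (prod_on (F n) A) (\sum_(q \in A) R n q).
Proof.
move=> Fn AU; apply: zfree_prod_on => [q /AU[_ dq]|]; first by apply: Fn; rewrite dq.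
by apply: sub_finite_set (up_fin p n) => q [/AU].
Qed.

(** By adequacy source and target have the same finite rank, so [zfree_inj_surj] applies. *)
Lemma J_pure_surj n p : (n < deg p)%N -> F_zfree n -> J_inj n p -> J_pure n p ->
  J_surj n p.
Proof.
move=> np Fn inj pur y.
have JU : J p n `<=` up p n by apply: (lc_sub hJ); exact: ltnW.
pose f := restrict JU \o @to_up _ _ deg (F n) n p : {additive _ -> _}.
have fE x q (h : (p <= q)%O) (Jq : J p n q) : prod_at (f x) Jq = fmap (F n) h x.
  by rewrite (restrict_at _ _ _ (JU q Jq)) to_up_at.
have fR y' : range f y' <-> exists x : F n p, forall q (h : (p <= q)%O) (Jq : J p n q),
    fmap (F n) h x = prod_at y' Jq.
  split=> [[x _ <-]|[x xE]]; first by exists x => q h Jq; rewrite fE.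
  exists x => //; apply: prod_ext => q Jq; have [h _] := JU q Jq.
  by rewrite fE xE.
apply/fR; apply: (@zfree_inj_surj _ _ f (R n p)).
- exact/Fn/ltnW.
- by rewrite (adequate_R aJ np); exact: (zfree_prod_sub Fn JU).
- by move=> x fx; apply: inj => q h Jq; rewrite -fE fx.
- move=> v k k0 /fR[x xE]; apply/fR; apply: pur k0 _; exists x => q h Jq.
  by rewrite xE prod_atMz.
Qed.

Lemma normal_rep n p (z : prod_on (F n) (up p n)) : J_surj n p -> (n <= deg p)%N ->
  exists x : F n p, forall q (Uq : up p n q), J p n q -> prod_at (z - to_up x) Uq = 0.
Proof.
move=> surj np; have JU := lc_sub hJ np.
have [x xE] := surj (restrict JU z); exists x => q Uq Jq.
by rewrite prod_atB (to_up_at _ _ Uq.1) (xE q _ Jq) (restrict_at _ _ _ Uq) subrr.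
Qed.

(** The recursion for [Rnum] is the rank formula for the cokernel of [to_up], so it remains to see
    that [to_up] is injective with torsion-free cokernel. *)
Lemma F_zfreeS n : F_zfree n -> (forall p, (n < deg p)%N -> J_inj n p /\ J_surj n p) ->
  F_zfree n.+1.
Proof.
move=> Fn Jn p np; have [inj surj] := Jn p np.
have to0 (x : F n p) : (forall q (Uq : up p n q), J p n q -> prod_at (to_up x) Uq = 0) -> x = 0.
  move=> x0; apply: inj => q h Jq; have [_ dq] := lc_sub hJ (ltnW np) Jq.
  by rewrite -(x0 q (conj h dq) Jq); rewrite (to_up_at _ _ h).
have Uf : zfree (prod_on (F n) (up p n)) (\sum_(q \in up p n) R n q).
  exact: (@zfree_prod_sub n p).
apply: zfree_coker => //.
- exact/Fn/ltnW.
- by move=> x x0; apply: to0 => q Uq _; rewrite x0.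
(* Here [x] agrees with [v] on $J^p_n$, so [y - x *~ k] restricts to 0 there and is 0. Hence [k]
   kills [v - to_up x]. *)
move=> v k k0 [y _ yE]; have [x xE] := normal_rep v surj (ltnW np).
exists x => //; apply/eqP; rewrite -subr_eq0 -oppr_eq0 opprB; apply/eqP.
apply: (zfree_torsionfree Uf k0).
suff y0 : y - x *~ k = 0 by rewrite mulrzBl -raddfMz -yE -raddfB y0 raddf0.
apply: to0 => q Uq Jq; rewrite raddfB raddfMz /= yE -mulrzBl prod_atMz.
by rewrite (xE q Uq Jq) mul0rz.
Qed.

(** An empty $J^p_0$ would turn the adequacy equation into $1 = 0$, since $R^p_0 = 1$. *)
Lemma J0 p : (0 < deg p)%N -> exists q, J p 0 q.
Proof.
move=> p0; apply: contrapT => J0; have := adequate_R aJ p0.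
rewrite fsbig1 // => q Jq; by case: J0; exists q.
Qed.

Lemma J_inj0 p : (0 < deg p)%N -> J_inj 0 p.
Proof.
move=> p0 x x0; have [q Jq] := J0 p0; have [h _] := lc_sub hJ (ltnW p0) Jq.
exact: (x0 q h Jq).
Qed.

(** All entries of [k] times [y] equal the integer [x], so all entries of [y] agree, and any one of
    them is the preimage. *)
Lemma J_pure0 p : (0 < deg p)%N -> J_pure 0 p.
Proof.
move=> p0 y k k0 [x xE]; have [q Jq] := J0 p0.
have JU := lc_sub hJ (ltnW p0).
exists (prod_at y Jq) => r h Jr; apply: (mulIf k0).
have := xE q (JU q Jq).1 Jq; have := xE r h Jr => /= -> /=.
by rewrite !mulrzz.
Qed.

Section Step.
Variables (n : nat) (p : P).
Hypotheses (np : (n.+1 < deg p)%N) (Fn : F_zfree n).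
Hypothesis Jn : forall p, (n < deg p)%N -> J_inj n p /\ J_surj n p.

(** Uniqueness of the representative that vanishes on $J^q_n$. *)
Lemma J_vanish q (z : prod_on (F n) (up q n)) : (n < deg q)%N ->
  (forall r (Ur : up q n r), J q n r -> prod_at z Ur = 0) -> toF z = 0 -> z = 0.
Proof.
move=> nq z0 /toF_eq0[x xz]; have [inj _] := Jn nq.
rewrite -xz (inj x) ?raddf0 // => r h Jr.
have Ur := lc_sub hJ (ltnW nq) Jr.
by rewrite -(z0 r Ur Jr) -xz (to_up_at _ _ h).
Qed.

(** Existence of the representative that vanishes on $J^q_n$; below it is called normal. *)
Lemma J_normal q (c : F n.+1 q) : (n < deg q)%N -> exists z : prod_on (F n) (up q n),
  toF z = c /\ forall r (Ur : up q n r), J q n r -> prod_at z Ur = 0.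
Proof.
move=> nq; have [z <-] := toF_surj c.
have [x xE] := normal_rep z (Jn nq).2 (ltnW nq).
exists (z - to_up x); split=> //; apply/toF_eqP; exists (- x).
by rewrite raddfN addrAC subrr add0r.
Qed.

Lemma J_cover r : up p n r -> exists2 q, J p n.+1 q & up q n r.
Proof. by rewrite -(lc_cover hJ (ltnW np)) => -[q]; exists q. Qed.

Lemma J_up q : J p n.+1 q -> (p <= q)%O /\ (n < deg q)%N.
Proof. by move=> /(lc_sub hJ (ltnW np))[pq ->]. Qed.

(** By condition (b) of a local covering, the normal representative of [c] restricts to the normal
    representative at each [q] in $J^p_{n+1}$, which is 0. By condition (a) these [q] reach every
    index. *)
Lemma J_injS : J_inj n.+1 p.
Proof.
move=> c c0; have [z [zc z0]] := J_normal c (ltnW np).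
suff zE : z = 0 by rewrite -zc zE; apply/toF_eq0; exists 0; rewrite raddf0.
apply: prod_ext => r Ur; have [q Jq qr] := J_cover Ur; have [pq nq] := J_up Jq.
have := c0 q pq Jq; rewrite -zc toF_fmap => /(J_vanish nq) zq.
rewrite -(restrict_at (up_sub pq) z qr Ur) zq // => s Us Js.
by rewrite (restrict_at _ _ _ (up_sub pq Us)) z0 //; exact: (lc_mono hJ (ltnW np) Jq).
Qed.

(** Let [t q] be the normal representative of the component of [y] at [q]. By uniqueness [k] times
    [t q] is the restriction of [z], so torsion-freeness makes the [t q] agree on overlaps, and they
    glue. *)
Lemma J_pureS : J_pure n.+1 p.
Proof.
move=> y k k0 [c cE]; have [z [zc z0]] := J_normal c (ltnW np).
pose t q Jq := cid (J_normal (prod_at y Jq) (@J_up q Jq).2).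
have zt q (Jq : J p n.+1 q) (pq : (p <= q)%O) :
    restrict (up_sub pq) z = sval (t q Jq) *~ k.
  have [tq t0] := svalP (t q Jq).
  apply/eqP; rewrite -subr_eq0; apply/eqP/(J_vanish (J_up Jq).2) => [r Ur Jr|].
    rewrite prod_atB prod_atMz t0 // (restrict_at _ _ _ (up_sub pq Ur)) z0.
      by rewrite mul0rz subr0.
    exact: (lc_mono hJ (ltnW np) Jq).
  have [f fE] := additive_of (@toFB n q).
  by rewrite toFB -[toF (_ *~ _)]fE raddfMz /= fE tq -toF_fmap zc cE subrr.
have kt q (Jq : J p n.+1 q) r (Uq : up q n r) (Ur : up p n r) :
    prod_at (sval (t q Jq)) Uq *~ k = prod_at z Ur.
  have [pq _] := J_up Jq.
  by rewrite -prod_atMz -(zt q Jq pq) (restrict_at _ _ _ Ur).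
(* The index [q] above which [r] lies is chosen separately for each [r]; [kt] and torsion-freeness
   show that the value does not depend on it. *)
pose x := prod_mk (fun r (Ur : up p n r) =>
  let q := cid2 (J_cover Ur) in prod_at (sval (t _ (s2valP q))) (s2valP' q)).
exists (toF x) => q pq Jq; rewrite toF_fmap -(svalP (t q Jq)).1; congr toF.
apply: prod_ext => r Ur; rewrite (restrict_at _ _ _ (up_sub pq Ur)) prod_mkE.
apply/eqP; rewrite -subr_eq0; apply/eqP.
have Fr : zfree (F n r) (R n r) by apply: Fn; rewrite (Ur.2).
apply: (zfree_torsionfree Fr k0); rewrite mulrzBl.
by rewrite !(kt _ _ _ _ (up_sub pq Ur)) subrr.
Qed.

End Step.

(** The two claims need a joint induction: freeness in degree [n.+1] uses both [J] properties in
    degree [n], and surjectivity in degree [n.+1] compares ranks of groups already known to be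
    free. *)
Lemma F_structure n :
  F_zfree n /\ forall p, (n < deg p)%N -> J_inj n p /\ J_surj n p.
Proof.
elim: n => [|n [Fn Jn]].
  have F0 : F_zfree 0 by move=> p _; exact: zfree_int.
  split=> // p p0; split; first exact: J_inj0.
  by apply: J_pure_surj; [|exact: F0|exact: J_inj0|exact: J_pure0].
have FS : F_zfree n.+1 by exact: F_zfreeS.
split=> // p np; split; first exact: J_injS.
by apply: J_pure_surj => //; [exact: J_injS|exact: J_pureS].
Qed.

(** Holds in every degree: below [n] the group is 0, at [n] the component at [p] is the identity,
    and above [n] already the components in $J^p_n$ detect [x]. *)
Lemma to_up_inj n p (x : F n p) : to_up (deg := deg) (n := n) x = 0 -> x = 0.
Proof.
move=> x0; have [_ Jn] := F_structure n.
have xU q (Uq : up p n q) : fmap (F n) Uq.1 x = 0 by rewrite -(to_up_at x Uq) x0.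
have [/F_trivial//|np|np] := ltngtP (deg p) n.
  apply: (Jn p np).1 => q h Jq; have Uq := lc_sub hJ (ltnW np) Jq.
  by rewrite -(xU q Uq); exact: fmap_irr.
by rewrite -(xU p (conj (lexx p) np)) fmap_id.
Qed.

End Adequate.
End Graded.

(** * Flabby functors *)

Section Flabby.
Context {disp : Order.disp_t} {P : porderType disp}.

(* Sections over U are total families whose values outside U are junk. *)
Definition section_on (G : functor P) (U : set P) (y : dprod G) :=
  forall p q (h : (p <= q)%O), U p -> fmap G h (y p) = y q.

Definition flabby (G : functor P) := forall p (y : dprod G),
  section_on (upper p) y ->
  exists e : G p, forall q (h : (p <= q)%O), (p < q)%O -> fmap G h e = y q.

Section Coind.
Variables (deg : P -> nat) (G : functor P) (n : nat).

Definition coind_fmap p q (h : (p <= q)%O) :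
    {additive prod_on G (up deg p n) -> prod_on G (up deg q n)} :=
  restrict (@up_sub _ _ deg n p q h).

Lemma coind_id p (h : (p <= p)%O) x : coind_fmap h x = x.
Proof. by apply: prod_ext => q Uq; rewrite (restrict_at _ _ _ Uq). Qed.

Lemma coind_comp p q r (h : (p <= q)%O) (k : (q <= r)%O) (l : (p <= r)%O) x :
  coind_fmap k (coind_fmap h x) = coind_fmap l x.
Proof.
apply: prod_ext => s Us.
by rewrite (restrict_at _ _ _ (up_sub k Us)) !(restrict_at _ _ _ (up_sub l Us)).
Qed.

(** The right Kan extension to the poset of [G] restricted to the discrete set of objects of degree
    [n]; for $G = F_n$ it is $F'_n$. *)
Definition coind : functor P := Functor coind_id coind_comp.

Lemma coind_flabby : flabby coind.
Proof.
move=> p y yS.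
(* The component at [p] itself, present only if [p] has degree [n], is invisible from any [q > p]
   and is set to 0. *)
pose e := prod_mk (fun q (Uq : up deg p n q) => match pselect (p < q)%O with
  | left _ => prod_at (y q : prod_on G (up deg q n)) (conj (lexx q) Uq.2)
  | right _ => 0 end).
exists e => q h pq; apply: prod_ext => r Ur.
rewrite (restrict_at _ _ _ (up_sub h Ur)) prod_mkE; case: pselect => [_|]; last first.
  by case; exact: lt_le_trans Ur.1.
by rewrite -(yS q r Ur.1 pq) (restrict_at _ _ _ Ur).
Qed.

End Coind.

(* The subfunctor of constZ supported on an upper set U; it represents sections over U. *)
Section ConstOn.
Variables (U : set P) (Uup : forall p q, (p <= q)%O -> U p -> U q).

Lemma const_on_closed p : subgroup_closed [set x : int | U p \/ x = 0].
Proof.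
split=> [|x y /= [Up|->]]; [by right|by left|case=> [Up|->]; first by left].
by rewrite subrr; right.
Qed.

Lemma const_on_mem p q (h : (p <= q)%O) (x : sub_zmod (const_on_closed p)) :
  U q \/ sub_val x = 0.
Proof. by case: (sub_valE x) => [/(Uup h)|]; [left|right]. Qed.

Definition const_on_fun p q (h : (p <= q)%O) x :=
  to_sub (const_on_closed q) (const_on_mem h x).

Lemma const_on_additive p q (h : (p <= q)%O) : zmod_morphism (const_on_fun h).
Proof. by move=> x y; apply/val_inj. Qed.

HB.instance Definition _ p q (h : (p <= q)%O) :=
  GRing.isZmodMorphism.Build (sub_zmod (const_on_closed p)) (sub_zmod (const_on_closed q))
    (const_on_fun h) (const_on_additive h).

Definition const_on_fmap p q (h : (p <= q)%O) :
  {additive sub_zmod (const_on_closed p) -> sub_zmod (const_on_closed q)} :=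
  const_on_fun h.

Lemma const_on_id p (h : (p <= p)%O) x : const_on_fmap h x = x.
Proof. exact/val_inj. Qed.

Lemma const_on_comp p q r (h : (p <= q)%O) (k : (q <= r)%O) (l : (p <= r)%O) x :
  const_on_fmap k (const_on_fmap h x) = const_on_fmap l x.
Proof. exact/val_inj. Qed.

Definition const_on : functor P := Functor const_on_id const_on_comp.

End ConstOn.

Section ConstOnTrans.
Variables (U : set P) (Uup : forall p q, (p <= q)%O -> U p -> U q).

Lemma nat_trans_of (G H : functor P) (f : forall p, G p -> H p) :
  (forall p, zmod_morphism (f p)) ->
  (forall p q (h : (p <= q)%O) x, f q (fmap G h x) = fmap H h (f p x)) ->
  exists g : nat_trans G H, forall p x, g p x = f p x.
Proof.
move=> fB fN; pose g p := sval (cid (additive_of (fB p))).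
have gE p x : g p x = f p x by exact: (svalP (cid (additive_of (fB p)))).
have gN p q (h : (p <= q)%O) x : g q (fmap G h x) = fmap H h (g p x).
  by rewrite !gE fN.
by exists (NatTrans gN) => p x; exact: gE.
Qed.

Lemma const_on_section (G : functor P) (y : dprod G) : section_on U y ->
  exists f : nat_trans (const_on Uup) G, forall p (x : const_on Uup p),
    f p x = y p *~ sub_val x.
Proof.
move=> yS; apply: nat_trans_of => [p x z|p q h x]; first exact: mulrzBr.
rewrite raddfMz; case: (sub_valE x) => [Up|x0]; first by rewrite yS.
by rewrite /= x0 !mulr0z.
Qed.

End ConstOnTrans.

Lemma upper_up (p q r : P) : (q <= r)%O -> upper p q -> upper p r.
Proof. by move=> qr pq; exact: lt_le_trans qr. Qed.

(** A section over the objects above [p] is a transformation out of [Z']. Injectivity extends it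
    along the inclusion of [Z'] into [Z], and the value at 1 over [p] is the wanted extension. *)
Lemma injective_flabby (I : functor P) : injective_functor I -> flabby I.
Proof.
move=> inj p y yS.
have Vup q r : (q <= r)%O -> [set q | (p <= q)%O] q -> [set q | (p <= q)%O] r.
  by move=> qr pq; exact: le_trans qr.
pose Z' := const_on (@upper_up p); pose Z := const_on Vup.
have mem q (x : Z' q) : (p <= q)%O \/ sub_val x = 0.
  by case: (sub_valE x) => [/ltW|]; [left|right].
have [i iE] : exists i : nat_trans Z' Z, forall q x, i q x = to_sub (const_on_closed _ q) (mem q x).
  by apply: nat_trans_of => [q x z|q r h x]; apply: val_inj.
have [f fE] := const_on_section (@upper_up p) yS.
have iM : mono_trans i.
  by move=> q x z; rewrite !iE => /(congr1 (@sub_val _ _ _)) /= xz; exact: val_inj.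
have [g gE] := inj _ _ i f iM.
pose one q (h : (p <= q)%O) : Z q := @to_sub _ _ (const_on_closed _ q) 1 (or_introl h).
exists (g p (one p (lexx p))) => q h pq; rewrite -ntapp_nat.
have one' : (upper p q : Prop) \/ (1 : int) = 0 by left.
pose u : Z' q := to_sub (const_on_closed _ q) one'.
rewrite (_ : fmap _ _ _ = i q u); last by rewrite iE; exact: val_inj.
by rewrite gE fE mulr1z.
Qed.

End Flabby.

(** * Exactness on sections of a complex of flabby functors *)

Section Exactness.
Context {disp : Order.disp_t} {P : porderType disp} (deg : P -> nat).
Hypothesis hdeg : graded deg.

Lemma gt_wf : well_founded (fun q p : P => (p < q)%O).
Proof.
suff acc n : forall p, (deg p < n)%N -> Acc (fun q p : P => (p < q)%O) p.
  by move=> p; exact: (acc (deg p).+1).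
elim: n => [p|n IHn p pn]; [by rewrite ltn0|constructor=> q pq].
have qp := deg_lt hdeg pq.
by apply: IHn; exact: leq_trans qp _.
Qed.

(** Well-founded recursion from larger to smaller objects. The first hypothesis says that [Phi] at
    [p] sees only values strictly above [p], so the recursion can pad with 0 and the condition is
    proved afterwards by induction. *)
Lemma downward_choice (T : P -> zmodType) (Phi : forall p, dprod T -> T p -> Prop) :
  (forall p y y' e, (forall q, (p < q)%O -> y q = y' q) -> Phi p y e -> Phi p y' e) ->
  (forall p y, (forall q, (p < q)%O -> Phi q y (y q)) -> exists e, Phi p y e) ->
  exists y : dprod T, forall p, Phi p y (y p).
Proof.
move=> loc step.
pose tot p (rec : forall q, (p < q)%O -> T q) : dprod T := fun q =>
  match pselect (p < q)%O with left h => rec q h | right _ => 0 end.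
pose body p rec : T p := match pselect (exists e, Phi p (tot p rec) e) with
  | left h => sval (cid h) | right _ => 0 end.
pose y : dprod T := Fix gt_wf (fun p => T p : Type) body.
have yE p : y p = body p (fun q _ => y q).
  rewrite /y Fix_eq // => q f g fg; congr body.
  by apply: functional_extensionality_dep => r; apply: functional_extensionality_dep => h.
exists y => p; elim/(well_founded_ind gt_wf): p => p IHp.
have agree q : (p < q)%O -> tot p (fun q _ => y q) q = y q.
  by rewrite /tot; case: pselect.
apply: (loc p (tot p (fun q _ => y q))); first exact: agree.
rewrite yE /body; case: pselect => [h|]; first exact: svalP (cid h).
case; apply: step => q pq; rewrite agree //; apply: loc (IHp q pq) => r qr.
by rewrite agree //; exact: lt_trans qr.
Qed.

Section Exact.
Variables (E : nat -> functor P) (D : forall n, nat_trans (E n) (E n.+1)).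
Hypothesis flab : forall n, flabby (E n).
Hypothesis D_inj0 : forall p x, D 0 p x = 0 -> x = 0.
Hypothesis DD : forall n p x, D n.+1 p (D n p x) = 0.
Hypothesis D_exact : forall n p x, D n.+1 p x = 0 -> exists y, D n p y = x.

(** The one-object case of [section_exact]: a lift of [z] already chosen strictly above [p] is to be
    continued to [p]. *)
Definition extends n := forall p (y : dprod (E n)) (z : E n.+1 p),
  section_on (upper p) y ->
  (forall q (h : (p <= q)%O), (p < q)%O -> D n q (y q) = fmap (E n.+1) h z) ->
  D n.+1 p z = 0 ->
  exists e, D n p e = z /\ forall q (h : (p <= q)%O), (p < q)%O -> fmap (E n) h e = y q.

Definition section_exact n := forall (U : set P) (z : dprod (E n.+1)),
  (forall p q, (p <= q)%O -> U p -> U q) ->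
  section_on U z -> (forall p, U p -> D n.+1 p (z p) = 0) ->
  exists2 y : dprod (E n), section_on U y & forall p, U p -> D n p (y p) = z p.

Lemma extends_section_exact n : extends n -> section_exact n.
Proof.
move=> ext U z Uup zS zD.
(* Nothing is required outside [U], where the lift is junk. *)
pose Phi p (y : dprod (E n)) (e : E n p) := U p -> D n p e = z p /\
  forall q (h : (p <= q)%O), (p < q)%O -> fmap (E n) h e = y q.
have [||y yP] := @downward_choice (E n) Phi.
- move=> p y y' e yy' ye Up; have [eD eS] := ye Up; split=> // q h pq.
  by rewrite eS // yy'.
- move=> p y yP; have [Up|nUp] := pselect (U p); last by exists 0.
  have yS : section_on (upper p) y.
    move=> q r h pq; have [qr|/eqP nqr] := eqVneq q r.
      by case: _ / qr h => h; rewrite fmap_id.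
    have lt_qr : (q < r)%O by rewrite lt_neqAle h andbT; apply/eqP.
    by have [_ ->] := yP q pq (Uup p q (ltW pq) Up).
  have [q h pq||e eP] := ext p y (z p) yS; last by exists e.
    by have [-> _] := yP q pq (Uup p q h Up); rewrite zS.
  exact: zD.
exists y => [p q h Up|p Up]; last by have [] := yP p Up.
have [pq|/eqP npq] := eqVneq p q.
  by case: _ / pq h => h; rewrite fmap_id.
have lt_pq : (p < q)%O by rewrite lt_neqAle h andbT; apply/eqP.
by have [_ ->] := yP p Up.
Qed.

(** A pointwise lift [e] of [z] differs from [y] above [p] by a cocycle [v]. The previous case on
    sections gives [w] with [D w = v]; flabbiness continues [w] to [w0] at [p], and [e - D w0]
    restricts to [y]. For [n = 0] lifts are unique. *)
Lemma extends_all n : extends n.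
Proof.
elim: n => [|n IHn] p y z yS yD zD.
  have [e eD] := D_exact zD; exists e; split=> // q h pq.
  apply/eqP; rewrite -subr_eq0; apply/eqP/D_inj0.
  by rewrite raddfB ntapp_nat eD yD ?subrr.
have [e eD] := D_exact zD.
pose v : dprod (E n.+1) := fun q => match pselect (p <= q)%O with
  | left h => fmap (E n.+1) h e - y q | right _ => 0 end.
have vE q (h : (p <= q)%O) : v q = fmap (E n.+1) h e - y q.
  by rewrite /v; case: pselect => // h'; rewrite (bool_irrelevance h' h).
have vS : section_on (upper p) v.
  move=> q r h pq; have pr := le_trans (ltW pq) h.
  by rewrite (vE q (ltW pq)) (vE r pr) raddfB fmap_comp yS.
have [|w wS wD] := extends_section_exact IHn (@upper_up _ _ p) vS.
  move=> q pq; rewrite (vE q (ltW pq)) raddfB ntapp_nat eD.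
  by rewrite (yD q (ltW pq)) // subrr.
have [w0 w0E] := flab wS; exists (e - D n p w0); split.
  by rewrite raddfB DD subr0.
move=> q h pq; rewrite raddfB -ntapp_nat w0E // wD // (vE q h).
by rewrite opprB addrC subrK.
Qed.

Lemma sections_exact n : section_exact n.
Proof. exact/extends_section_exact/extends_all. Qed.

End Exact.
End Exactness.

(** * Comparison with an injective resolution *)

Lemma cohomology_isomorphic (X Y : cochain) (f : forall n, {additive X n -> Y n}) :
  (forall n x, f n.+1 (cdiff X n x) = cdiff Y n (f n x)) ->
  (forall n y, cdiff Y n y = 0 ->
    exists2 x, cdiff X n x = 0 & coboundary (C := Y) (f n x - y)) ->
  (forall n x, cdiff X n x = 0 -> coboundary (C := Y) (f n x) -> coboundary (C := X) x) ->
  forall n, isomorphic (cohomology X n) (cohomology Y n).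
Proof.
move=> fd fS fI n.
have cocycle (x : ker (cdiff X n)) : cdiff Y n (f n (sub_val x)) = 0.
  by rewrite -fd (sub_valE x) raddf0.
pose g (x : ker (cdiff X n)) : cohomology Y n :=
  quot_class (@coboundary_closed Y n) (to_sub (ker_closed (cdiff Y n)) (cocycle x)).
have gB : zmod_morphism g.
  move=> x y; rewrite /g -raddfB; congr quot_class.
  by apply: val_inj; exact: (raddfB (f n)).
have [h hE] := additive_of gB; apply: (@quot_isomorphic _ _ _ _ h) => [y|x].
  have [[y' y'K] <-] : exists z, quot_class (@coboundary_closed Y n) z = y.
    by exists (quot_repr y); exact: quot_reprK.
  have [x x0 xy] := fS n y' (asboolW y'K).
  exists (to_sub (ker_closed (cdiff X n)) x0); rewrite hE /g.
  by apply/eqP; rewrite -subr_eq0 -raddfB; apply/eqP/quot_class_eq0.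
rewrite hE quot_class_eq0; split=> [|] /=; first exact/fI/(sub_valE x).
case: n x cocycle g gB h hE => [|n] x _ _ _ _ _ /=; first by move=> ->; rewrite raddf0.
by move=> [u _ <-]; exists (f n u) => //; rewrite -fd.
Qed.

Section Resolution.
Context {disp : Order.disp_t} {P : porderType disp} (deg : P -> nat).
Local Notation F := (F deg).
Local Notation up := (up deg).
Hypothesis toinj : forall n p (x : F n p), to_up (deg := deg) (n := n) x = 0 -> x = 0.

Local Notation A n := (coind deg (F n) n).

(** Over [p] the family of classes of [x] is the image under [to_up] of the class of [x] in
    $F_{n+1}(p)$, so it dies in the next cokernel. *)
Lemma dFK n x : dF (dF x) = 0 :> prod_on (F n.+2) (Ob deg n.+2).
Proof.
apply: prod_ext => p dp; apply/toF_eq0; exists (toF (restrict (@up_Ob _ _ deg p n) x)).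
apply: prod_ext => q Uq; rewrite (restrict_at _ _ _ (up_Ob Uq)) (to_up_at _ _ Uq.1).
rewrite toF_fmap; congr toF; apply: prod_ext => r Ur.
by rewrite (restrict_at _ _ _ (up_sub Uq.1 Ur)) !(restrict_at _ _ _ (up_Ob Ur)).
Qed.

Definition ob_complex : cochain :=
  @Cochain (fun n => prod_on (F n) (Ob deg n)) (fun n => @dF _ _ deg n) dFK.

(** Splices the short exact sequences $0 \to F_n \to A_n \to F_{n+1} \to 0$, whose left map is
    injective by [toinj]. *)
Definition dA n p (z : A n p) : A n.+1 p := to_up (deg := deg) (n := n.+1) (toF z).

Lemma toF_nat n p q (h : (p <= q)%O) (z : A n p) :
  toF (fmap (A n) h z) = fmap (F n.+1) h (toF z).
Proof. by rewrite toF_fmap. Qed.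

Lemma to_up_nat n p q (h : (p <= q)%O) (x : F n p) :
  to_up (fmap (F n) h x) = fmap (A n) h (to_up x).
Proof.
apply: prod_ext => r Ur; rewrite (restrict_at _ _ _ (up_sub h Ur)).
by rewrite (to_up_at _ _ Ur.1) (to_up_at _ _ (le_trans h Ur.1)); exact: fmap_comp.
Qed.

Lemma dA_nat n p q (h : (p <= q)%O) (z : A n p) :
  dA (fmap (A n) h z) = fmap (A n.+1) h (dA z).
Proof. by rewrite /dA toF_nat to_up_nat. Qed.

Lemma dAB n p : zmod_morphism (@dA n p).
Proof. by move=> x y; rewrite /dA toFB raddfB. Qed.

Lemma dA0 n p : dA (0 : A n p) = 0.
Proof. by rewrite -(subrr 0) dAB subrr. Qed.

Lemma toF_to_up n p (x : F n p) : toF (to_up x) = 0.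
Proof. by apply/toF_eq0; exists x. Qed.

Lemma dA_to_up n p (x : F n p) : dA (to_up x) = 0.
Proof. by rewrite /dA toF_to_up raddf0. Qed.

Lemma dA_eq0 n p (z : A n p) : dA z = 0 -> exists x, z = to_up x.
Proof. by move=> /toinj /toF_eq0[x <-]; exists x. Qed.

Lemma dAK n p (z : A n p) : dA (dA z) = 0.
Proof. exact: dA_to_up. Qed.

Lemma dA_exact n p (z : A n.+1 p) : dA z = 0 -> exists y, dA y = z.
Proof.
by move=> /dA_eq0[x ->]; have [y <-] := toF_surj x; exists y.
Qed.

Variable I : injective_resolution (constZ P).

Lemma res_diffK n p x : res_diff I n.+1 p (res_diff I n p x) = 0.
Proof. by apply/res_exactS; exists x. Qed.

Lemma extend_to_coind n (psi : nat_trans (F n) (I n)) :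
  exists phi : nat_trans (A n) (I n), forall p x, phi p (to_up x) = psi p x.
Proof.
have [u uE] : exists u : nat_trans (F n) (A n), forall p x, u p x = to_up x.
  by apply: nat_trans_of => [p|p q h x]; [exact: raddfB|exact: to_up_nat].
have uM : mono_trans u.
  by move=> p; apply: additive_inj => x; rewrite uE => /toinj.
have [phi phiE] := res_inj psi uM.
by exists phi => p x; rewrite -phiE uE.
Qed.

Lemma descend_to_F n (phi : nat_trans (A n) (I n)) :
  (forall p x, res_diff I n p (phi p (to_up x)) = 0) ->
  exists psi : nat_trans (F n.+1) (I n.+1),
    forall p z, psi p (toF z) = res_diff I n p (phi p z).
Proof.
move=> phi0.
pose f p (c : F n.+1 p) := res_diff I n p (phi p (quot_repr c : A n p)).
have fE p (z : A n p) : f p (toF z) = res_diff I n p (phi p z).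
  have /toF_eqP[x xz] : toF (quot_repr (toF z)) = toF z by exact: quot_reprK.
  apply/eqP; rewrite -subr_eq0 -raddfB -raddfB.
  by have := phi0 p x; rewrite xz => /eqP.
have [||psi psiE] := @nat_trans_of _ _ (F n.+1) (I n.+1) f.
- move=> p c c'; have [z <-] := toF_surj c; have [z' <-] := toF_surj c'.
  by rewrite -toFB !fE !raddfB.
- move=> p q h c; have [z <-] := toF_surj c.
  by rewrite -toF_nat !fE !ntapp_nat.
by exists psi => p z; rewrite psiE fE.
Qed.

(** A map $F_n \to I_n$ extends to $A_n$ because $I_n$ is injective. If the differential of [I]
    kills it, the composite $A_n \to I_{n+1}$ vanishes on $F_n$ and descends to $F_{n+1}$. Each
    [state] records such a pair of maps. *)
Lemma comparison_map : exists phi : forall n, nat_trans (A n) (I n),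
  (forall p x, phi 0 p (to_up x) = res_aug I p x) /\
  (forall n p z, phi n.+1 p (dA z) = res_diff I n p (phi n p z)).
Proof.
pose state n := {s : nat_trans (F n) (I n) * nat_trans (A n) (I n) |
  (forall p x, s.2 p (to_up x) = s.1 p x) /\
  (forall p x, res_diff I n p (s.1 p x) = 0)}.
have [phi0 phi0E] := @extend_to_coind 0 (res_aug I).
have aug0 p x : res_diff I 0 p (res_aug I p x) = 0 by apply/res_exact0; exists x.
pose s0 : state 0 := exist _ (res_aug I : nat_trans (F 0) (I 0), phi0) (conj phi0E aug0).
have step n (s : state n) : exists s' : state n.+1,
    forall p z, (sval s').1 p (toF z) = res_diff I n p ((sval s).2 p z).
  case: s => -[psi phi] [/= phiE psi0].
  have [|psi' psi'E] := @descend_to_F n phi; first by move=> p x; rewrite phiE psi0.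
  have [phi' phi'E] := extend_to_coind psi'.
  have psi'0 p x : res_diff I n.+1 p (psi' p x) = 0.
    by have [z <-] := toF_surj x; rewrite psi'E res_diffK.
  by exists (exist _ (psi', phi') (conj phi'E psi'0)).
pose s := nat_rect state s0 (fun n sn => sval (cid (step n sn))).
exists (fun n => (sval (s n)).2); split=> [p x|n p z]; first exact: phi0E.
have [sE _] := svalP (s n.+1); rewrite sE.
exact: (svalP (cid (step n (s n)))).
Qed.

End Resolution.

(** * The mapping cone of the comparison map *)

Section DirectSum.
Context {disp : Order.disp_t} {P : porderType disp} (G H : functor P).

Definition dsum_fun p q (h : (p <= q)%O) (x : G p * H p) : (G q * H q)%type :=
  (fmap G h x.1, fmap H h x.2).

Lemma dsum_additive p q (h : (p <= q)%O) : zmod_morphism (dsum_fun h).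
Proof. by move=> x y; rewrite /dsum_fun !raddfB. Qed.

HB.instance Definition _ p q (h : (p <= q)%O) :=
  GRing.isZmodMorphism.Build (G p * H p)%type (G q * H q)%type
    (dsum_fun h) (dsum_additive h).

Definition dsum_fmap p q (h : (p <= q)%O) :
  {additive (G p * H p)%type -> (G q * H q)%type} := dsum_fun h.

Lemma dsum_id p (h : (p <= p)%O) x : dsum_fmap h x = x.
Proof. by case: x => x y; congr pair; exact: fmap_id. Qed.

Lemma dsum_comp p q r (h : (p <= q)%O) (k : (q <= r)%O) (l : (p <= r)%O) x :
  dsum_fmap k (dsum_fmap h x) = dsum_fmap l x.
Proof. by congr pair; exact: fmap_comp. Qed.

Definition dsum : functor P := Functor dsum_id dsum_comp.

Lemma dsum_flabby : flabby G -> flabby H -> flabby dsum.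
Proof.
move=> fG fH p y yS.
have [|e eE] := fG p (fun q => (y q).1); first by move=> q r h /(yS q r h) <-.
have [|e' e'E] := fH p (fun q => (y q).2); first by move=> q r h /(yS q r h) <-.
by exists (e, e') => q h pq; rewrite [RHS]surjective_pairing -(eE q h) // -(e'E q h).
Qed.

End DirectSum.

Section ConeMap.
Context {disp : Order.disp_t} {P : porderType disp} (G H G' H' : functor P).

Lemma pair_trans (d : nat_trans G G') (f : nat_trans G H') :
  exists t : nat_trans G (dsum G' H'), forall p x, t p x = (d p x, f p x).
Proof.
apply: nat_trans_of => [p x y|p q h x]; first by rewrite !raddfB.
by rewrite !ntapp_nat.
Qed.

Lemma cone_trans (d : nat_trans G G') (f : nat_trans G H') (e : nat_trans H H') :
  exists t : nat_trans (dsum G H) (dsum G' H'),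
    forall p x, t p x = (d p x.1, f p x.1 - e p x.2).
Proof.
apply: nat_trans_of => [p [a i] [b j]|p q h x].
  have ef : f p (a - b) - e p (i - j) = (f p a - e p i) - (f p b - e p j).
    rewrite (raddfB (f p)) (raddfB (e p)) !opprB addrACA [RHS]addrACA.
    by congr (_ + _); exact: addrC.
  exact: (f_equal2 pair (raddfB (d p) a b) ef).
by rewrite /= !ntapp_nat -raddfB.
Qed.

End ConeMap.

Section Comparison.
Context {disp : Order.disp_t} {P : porderType disp} (deg : P -> nat).
Hypothesis hdeg : graded deg.
Local Notation F := (F deg).
Local Notation up := (up deg).
Hypothesis toinj : forall n p (x : F n p), to_up (deg := deg) (n := n) x = 0 -> x = 0.
Variable I : injective_resolution (constZ P).

Local Notation A n := (coind deg (F n) n).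
Variable phi : forall n, nat_trans (A n) (I n).
Hypothesis phi_aug : forall p x, phi 0 p (to_up x) = res_aug I p x.
Hypothesis phi_diff : forall n p z, phi n.+1 p (dA z) = res_diff I n p (phi n p z).

(** The mapping cone of [phi] with [I] shifted up by one; the minus sign in its differential
    [coneD_fun] makes the square vanish. *)
Definition cone n : functor P :=
  match n with 0 => A 0 | m.+1 => dsum (A m.+1) (I m) end.

Definition coneD_fun n : forall p, cone n p -> cone n.+1 p :=
  match n return forall p, cone n p -> cone n.+1 p with
  | 0 => fun p a => (dA a, phi 0 p a)
  | m.+1 => fun p x => (dA x.1, phi m.+1 p x.1 - res_diff I m p x.2)
  end.

Lemma cone_diff : exists D : forall n, nat_trans (cone n) (cone n.+1),
  forall n p x, D n p x = coneD_fun x.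
Proof.
have ex n : exists D : nat_trans (cone n) (cone n.+1), forall p x, D p x = coneD_fun x.
  have [d dE] : exists d : nat_trans (A n) (A n.+1), forall p z, d p z = dA z.
    by apply: nat_trans_of => [p|p q h z]; [exact: dAB|exact: dA_nat].
  case: n d dE => [|n] d dE.
    have [t tE] := pair_trans d (phi 0); exists t => p x.
    by rewrite tE dE.
  have [t tE] := cone_trans d (phi n.+1) (res_diff I n); exists t => p x.
  by rewrite tE dE.
by exists (fun n => sval (cid (ex n))) => n; exact: svalP (cid (ex n)).
Qed.

Lemma cone_flabby n : flabby (cone n).
Proof.
case: n => [|n]; first exact: coind_flabby.
by apply: dsum_flabby; [exact: coind_flabby|exact/injective_flabby/res_inj].
Qed.

Lemma coneDD n p (x : cone n p) : coneD_fun (coneD_fun x) = 0.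
Proof.
case: n x => [|n] x.
  have e (a : A 0 p) : phi 1 p (dA a) - res_diff I 0 p (phi 0 p a) = 0.
    by rewrite phi_diff subrr.
  exact: (f_equal2 pair (dAK x) (e x)).
case: x => a i.
have e (b : A n.+1 p) (j : I n p) :
    phi n.+2 p (dA b) - res_diff I n.+1 p (phi n.+1 p b - res_diff I n p j) = 0.
  by rewrite phi_diff (raddfB (res_diff I n.+1 p)) res_diffK subr0 subrr.
exact: (f_equal2 pair (dAK a) (e a i)).
Qed.

(** The kernel of [dA] in degree 0 is [constZ], on which [phi] is the augmentation of [I], a
    monomorphism. *)
Lemma coneD_inj0 p (x : cone 0 p) : coneD_fun x = 0 -> x = 0.
Proof.
case=> /(dA_eq0 toinj)[y ->]; rewrite phi_aug => y0.
rewrite (_ : y = 0) ?raddf0 //; apply: (res_aug_mono (i := I)).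
by rewrite y0 raddf0.
Qed.

Lemma coneD_exact n p (x : cone n.+1 p) : coneD_fun x = 0 -> exists y, coneD_fun y = x.
Proof.
have step m (a : A m.+1 p) (i : I m p) : dA a = 0 ->
    phi m.+1 p a - res_diff I m p i = 0 ->
    exists2 b : A m p, dA b = a & res_diff I m p (phi m p b - i) = 0.
  move=> /(dA_exact toinj)[b <-]; rewrite phi_diff -(raddfB (res_diff I m p)) => bi.
  by exists b.
case: x => a i [a0 ai0]; have [b ba bi] := step n a i a0 ai0.
case: n a i a0 ai0 b ba bi => [|n] a i a0 ai0 b ba bi.
  (* In degree 0 there is no earlier term of [I]: the cocycle comes from [constZ], and correcting
     [b] by it leaves [dA b] unchanged. *)
  have /res_exact0[c _ cE] := bi.
  exists (b - to_up c); apply: f_equal2; first by rewrite dAB dA_to_up subr0.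
  by rewrite (raddfB (phi 0 p)) phi_aug cE opprB addrC subrK.
have /res_exactS[j _ jE] := bi.
exists (b, j); apply: f_equal2 => //.
by rewrite jE opprB addrC subrK.
Qed.

Definition comparison_fun n (x : ob_complex deg n) : dprod (I n) :=
  fun p => phi n p (restrict (@up_Ob _ _ deg p n) x).

Lemma restrict_Ob_fmap n p q (h : (p <= q)%O) (x : ob_complex deg n) :
  fmap (A n) h (restrict (@up_Ob _ _ deg p n) x) = restrict (@up_Ob _ _ deg q n) x.
Proof.
apply: prod_ext => r Ur.
by rewrite (restrict_at _ _ _ (up_sub h Ur)) !(restrict_at _ _ _ (up_Ob Ur)).
Qed.

Lemma comparison_compatible n x : compatible (G := I n) (comparison_fun x).
Proof. by move=> p q h; rewrite -ntapp_nat restrict_Ob_fmap. Qed.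

Definition comparison n (x : ob_complex deg n) : lim (I n) :=
  to_sub (compatible_closed (I n)) (comparison_compatible x).

Lemma comparison_additive n : zmod_morphism (@comparison n).
Proof.
move=> x y; apply/val_inj/functional_extensionality_dep => p.
exact: (raddfB (phi n p)).
Qed.

HB.instance Definition _ n :=
  GRing.isZmodMorphism.Build (ob_complex deg n) (lim (I n)) (@comparison n)
    (@comparison_additive n).

Lemma restrict_dF n p (x : ob_complex deg n) :
  restrict (@up_Ob _ _ deg p n.+1) (dF x) = dA (restrict (@up_Ob _ _ deg p n) x : A n p).
Proof.
apply: prod_ext => q Uq; rewrite (restrict_at _ _ _ (up_Ob Uq)) (to_up_at _ _ Uq.1).
by rewrite toF_fmap; congr toF; exact/esym/(restrict_Ob_fmap Uq.1).
Qed.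

Lemma comparison_diff n (x : ob_complex deg n) :
  comparison (cdiff (ob_complex deg) n x) = cdiff (lim_complex I) n (comparison x).
Proof.
apply/val_inj/functional_extensionality_dep => p.
by rewrite /= /comparison_fun -phi_diff; congr (phi _ _ _); exact: restrict_dF.
Qed.

(** Global sections of $A_n$ are the elements of $C^n$: the entry at [p] of degree [n] is read off
    from [a p]. *)
Lemma section_of_A n (a : dprod (A n)) : section_on setT a ->
  exists x : ob_complex deg n, forall p, restrict (@up_Ob _ _ deg p n) x = a p.
Proof.
move=> aS.
pose x := prod_mk (A := Ob deg n) (fun p dp =>
  prod_at (a p : prod_on (F n) (up p n)) (conj (lexx p) dp)).
exists x => p; apply: prod_ext => q Uq; rewrite (restrict_at _ _ _ (up_Ob Uq)) prod_mkE.
by rewrite -(aS p q Uq.1 Logic.I) (restrict_at _ _ _ Uq).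
Qed.

Lemma dF_eq0 n (x : ob_complex deg n) :
  dF x = 0 <-> forall p, dA (restrict (@up_Ob _ _ deg p n) x : A n p) = 0.
Proof.
split=> [x0 p|x0]; first by rewrite -restrict_dF x0 raddf0.
apply: prod_ext => p dp; have Up : up p n.+1 p by split.
by rewrite -(restrict_at (@up_Ob _ _ deg p n.+1) _ Up) restrict_dF x0.
Qed.

Lemma cone_sections n (z : dprod (cone n.+1)) : section_on setT z ->
  (forall p, coneD_fun (z p) = 0) ->
  exists2 y : dprod (cone n), section_on setT y & forall p, coneD_fun (y p) = z p.
Proof.
have [D DE] := cone_diff => zS zD.
have [|||||y yS yD] := @sections_exact _ _ deg hdeg cone D cone_flabby _ _ _ n setT z _ zS.
- by move=> p x; rewrite DE; exact: coneD_inj0.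
- by move=> m p x; rewrite !DE; exact: coneDD.
- by move=> m p x; rewrite DE => /coneD_exact[y <-]; exists y; rewrite DE.
- by [].
- by move=> p _; rewrite DE; exact: zD.
by exists y => // p; rewrite -DE; exact: (yD p Logic.I).
Qed.

Lemma lim_ext (G : functor P) (x y : lim G) : (forall p, sub_val x p = sub_val y p) -> x = y.
Proof. by move=> xy; apply/val_inj/functional_extensionality_dep. Qed.

Lemma restrict_Ob_inj n (x y : ob_complex deg n) :
  (forall p, restrict (@up_Ob _ _ deg p n) x = restrict (@up_Ob _ _ deg p n) y) -> x = y.
Proof.
move=> xy; apply: prod_ext => p dp; have Up : up p n p by split.
by rewrite -!(restrict_at (@up_Ob _ _ deg p n) _ Up) xy.
Qed.

(** The pair [(0, z)] is a cocycle of the cone. The first component of a global primitive is the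
    cocycle [x], and the second one, absent for [n = 0], bounds the difference. *)
Lemma comparison_surj n (z : lim (I n)) : lim_map (res_diff I n) z = 0 ->
  exists2 x : ob_complex deg n, dF x = 0 &
    coboundary (C := lim_complex I) (comparison x - z : lim (I n)).
Proof.
move=> z0.
have zp p : res_diff I n p (sub_val z p) = 0.
  exact: (congr1 (fun t : lim (I n.+1) => sub_val t p) z0).
have zS : section_on (G := I n) setT (sub_val z).
  by move=> p q h _; exact: (sub_valE z).
have [|p|y yS yD] := @cone_sections n (fun p => (0, sub_val z p)).
- by move=> p q h _; congr pair; exact: zS.
- apply: f_equal2; first exact: dA0.
  by rewrite /= zp raddf0 subr0.
case: n z z0 zp zS y yS yD => [|n] z z0 zp zS y yS yD.
  have [x xE] := section_of_A yS; exists x.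
    by apply/dF_eq0 => p; rewrite xE; have [] := yD p.
  apply/eqP; rewrite subr_eq0; apply/eqP/lim_ext => p.
  by rewrite /= /comparison_fun xE; have [] := yD p.
have [|x xE] := @section_of_A n.+1 (fun p => (y p).1).
  by move=> p q h _; rewrite -(yS p q h).
have iS : compatible (G := I n) (fun p => (y p).2).
  by move=> p q h; rewrite -(yS p q h).
exists x; first by apply/dF_eq0 => p; rewrite xE; have [] := yD p.
exists (to_sub (compatible_closed (I n)) iS) => //; apply: lim_ext => p.
have yz : phi n.+1 p (y p).1 - res_diff I n p (y p).2 = sub_val z p.
  exact: (congr1 snd (yD p)).
rewrite [RHS](_ : _ = phi n.+1 p (y p).1 - sub_val z p); last by rewrite -xE.
by rewrite -yz opprB addrC subrK.
Qed.

(** If the image of [x] is the differential of [i], then [(x, i)] is a cocycle of the cone, and the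
    first component of a global primitive bounds [x]. *)
Lemma comparison_inj n (x : ob_complex deg n) : dF x = 0 ->
  coboundary (C := lim_complex I) (comparison x : lim (I n)) ->
  coboundary (C := ob_complex deg) x.
Proof.
move=> x0 fx; have dx := (dF_eq0 x).1 x0.
case: n x x0 fx dx => [|n] x x0 fx dx.
  apply: restrict_Ob_inj => p; rewrite raddf0; apply: coneD_inj0.
  rewrite /= dx; congr pair.
  exact: (congr1 (fun t : lim (I 0) => sub_val t p) fx).
have [i _ ix] := fx.
have ixp p : phi n.+1 p (restrict (@up_Ob _ _ deg p n.+1) x) = res_diff I n p (sub_val i p).
  by rewrite -[LHS]/(sub_val (comparison x) p) -ix.
have [||y yS yD] := @cone_sections n (fun p => (restrict (@up_Ob _ _ deg p n.+1) x, sub_val i p)).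
- move=> p q h _; congr pair; first exact: restrict_Ob_fmap.
  exact: (sub_valE i).
- move=> p; apply: f_equal2; first exact: dx.
  by apply/eqP; rewrite subr_eq0; apply/eqP/ixp.
have [x' x'E] : exists x' : ob_complex deg n, forall p,
    dA (restrict (@up_Ob _ _ deg p n) x' : A n p) = restrict (@up_Ob _ _ deg p n.+1) x.
  case: n x x0 fx dx i ix ixp y yS yD => [|n] x x0 fx dx i ix ixp y yS yD.
    by have [x' x'E] := section_of_A yS; exists x' => p; rewrite x'E; have [] := yD p.
  have [|x' x'E] := @section_of_A n.+1 (fun p => (y p).1).
    by move=> p q h _; rewrite -(yS p q h).
  by exists x' => p; rewrite x'E; have [] := yD p.
by exists x' => //; apply: restrict_Ob_inj => p; rewrite restrict_dF x'E.
Qed.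

Lemma comparison_quasi_iso n :
  isomorphic (cohomology (ob_complex deg) n) (derived_lim I n).
Proof.
apply: (@cohomology_isomorphic (ob_complex deg) (lim_complex I) (fun n => @comparison n)).
- exact: comparison_diff.
- exact: comparison_surj.
- exact: comparison_inj.
Qed.

End Comparison.

(** * Reduction along a global covering family *)

Lemma coboundary0 (X : cochain) n : coboundary (0 : X n).
Proof. by case: n => [|n] //=; exact: (im_closed _).1. Qed.

Section Reduction.
Context {disp : Order.disp_t} {P : porderType disp} (deg : P -> nat).
Local Notation F := (F deg).
Local Notation R := (Rnum deg).
Local Notation up := (up deg).
Local Notation C := (ob_complex deg).
Hypothesis toinj : forall n p (x : F n p), to_up (deg := deg) (n := n) x = 0 -> x = 0.
Variables (K : nat -> set P) (KOb : forall n, K n `<=` Ob deg n).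
Hypothesis Kinj : forall n, injective (@lim_restrict _ _ (F n) (K n)).

Lemma dF_additive n x y : dF (x - y) = dF x - dF y :> C n.+1.
Proof. exact: (raddfB (cdiff C n)). Qed.

Definition vanish n : set (C n) :=
  [set x | forall p (dp : Ob deg n p), K n p -> prod_at x dp = 0].

Lemma vanish_closed n : subgroup_closed (@vanish n).
Proof.
split=> [p dp _|x y x0 y0 p dp Kp] //.
by rewrite prod_atB x0 // y0 // subrr.
Qed.

(* Such a cocycle comes from an element of lim F_n vanishing on K n. *)
Lemma cocycle_vanish n (x : C n) : dF x = 0 -> vanish x -> x = 0.
Proof.
move=> /dF_eq0 x0 xK.
pose y p := sval (cid (dA_eq0 toinj (x0 p))).
have yE p : restrict (@up_Ob _ _ deg p n) x = to_up (y p).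
  exact: (svalP (cid (dA_eq0 toinj (x0 p)))).
have yC : compatible (G := F n) y.
  move=> p q h; apply/eqP; rewrite -subr_eq0; apply/eqP/toinj.
  by rewrite raddfB /= to_up_nat -!yE restrict_Ob_fmap subrr.
have y_at p (dp : deg p = n) : y p = prod_at x dp.
  have Up : up p n p by split.
  rewrite -(restrict_at (@up_Ob _ _ deg p n) _ Up) yE (to_up_at _ _ (lexx p)).
  by rewrite fmap_id.
have Y0 : to_sub (compatible_closed (F n)) yC = 0.
  apply: Kinj; apply: prod_ext => p Kp; have dp := KOb Kp.
  by rewrite [LHS](y_at p dp) xK.
apply: prod_ext => p dp; rewrite -y_at.
exact: (congr1 (fun t : lim (F n) => sub_val t p) Y0).
Qed.

Definition acyclic_part n : set (C n) := match n return set (C n) with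
  | 0 => @vanish 0
  | m.+1 => [set x | exists2 u : C m, vanish u & vanish (x - dF u : C m.+1)]
  end.

Lemma vanish_acyclic n (x : C n) : vanish x -> acyclic_part x.
Proof.
case: n x => // n x x0; exists 0; first exact: (vanish_closed n).1.
by rewrite -[dF 0]/(cdiff C n 0) raddf0 subr0.
Qed.

Lemma dF_acyclic n (x : C n) : acyclic_part x -> acyclic_part (dF x : C n.+1).
Proof.
case: n x => [x x0|n x [u u0 xu0]] /=.
  by exists x; rewrite // subrr; exact: (vanish_closed _).1.
exists (x - dF u) => //; rewrite dF_additive dFK subr0 subrr.
exact: (vanish_closed _).1.
Qed.

Lemma acyclic_closed n : subgroup_closed (@acyclic_part n).
Proof.
split=> [|x y]; first exact/vanish_acyclic/(vanish_closed n).1.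
case: n x y => [|n] x y; first exact: (vanish_closed 0).2.
move=> [u u0 xu] [v v0 yv]; exists (u - v); first exact: (vanish_closed n).2.
rewrite (_ : _ - _ = (x - dF u) - (y - dF v)); first exact: (vanish_closed n.+1).2.
by rewrite dF_additive !opprB addrACA [RHS]addrACA; congr (_ + _); exact: addrC.
Qed.

Definition reduced_ob n : zmodType := quot_zmod (acyclic_closed n).
Local Notation B := reduced_ob.

Definition toB n (x : C n) : B n := quot_class (acyclic_closed n) x.

Lemma toB_eqP n (x y : C n) : toB x = toB y <-> acyclic_part (x - y).
Proof.
rewrite /toB; split=> [xy|].
  by apply/(quot_class_eq0 (acyclic_closed n)); rewrite raddfB /= xy subrr.
by move=> /(quot_class_eq0 (acyclic_closed n)); rewrite raddfB => /eqP; rewrite subr_eq0 => /eqP.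
Qed.

Lemma toB_surj n (b : B n) : exists x, toB x = b.
Proof. by exists (quot_repr b); exact: quot_reprK. Qed.

Definition dB n (b : B n) : B n.+1 := toB (dF (quot_repr b) : C n.+1).

Lemma dB_toB n (x : C n) : dB (toB x) = toB (dF x : C n.+1).
Proof.
apply/toB_eqP; rewrite -dF_additive; apply: dF_acyclic; apply/toB_eqP.
exact: quot_reprK.
Qed.

Lemma toB_additive n : zmod_morphism (@toB n).
Proof. by move=> x y; rewrite /toB raddfB. Qed.

HB.instance Definition _ n :=
  GRing.isZmodMorphism.Build (C n) (B n) (@toB n) (@toB_additive n).

Lemma dB_additive n : zmod_morphism (@dB n).
Proof.
move=> a b; have [x <-] := toB_surj a; have [y <-] := toB_surj b.
by rewrite -toB_additive !dB_toB dF_additive toB_additive.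
Qed.

HB.instance Definition _ n :=
  GRing.isZmodMorphism.Build (B n) (B n.+1) (@dB n) (@dB_additive n).

Lemma dBK n (b : B n) : dB (dB b) = 0.
Proof.
by have [x <-] := toB_surj b; rewrite !dB_toB dFK raddf0.
Qed.

Definition reduced_complex : cochain := @Cochain reduced_ob (fun n => @dB n) dBK.

Lemma reduced_quasi_iso n : isomorphic (cohomology C n) (cohomology reduced_complex n).
Proof.
apply: (@cohomology_isomorphic C reduced_complex (fun n => @toB n)) => {}n.
- by move=> x; rewrite [RHS]dB_toB.
- move=> b; have [x <-] := toB_surj b; rewrite [cdiff _ _ _]dB_toB => dx.
  (* The element [dF (x - u)] is a cocycle vanishing on [K], hence 0, and [x - u] has the same class
     as [x] in the quotient. *)
  have [u u0 xu] : acyclic_part (dF x : C n.+1).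
    by rewrite -[dF x]subr0; apply/toB_eqP; rewrite dx raddf0.
  exists (x - u).
    by rewrite /= dF_additive; apply: cocycle_vanish; rewrite // -dF_additive dFK.
  have xuE : toB (x - u) = toB x.
    apply/toB_eqP/vanish_acyclic; rewrite addrAC subrr.
    by apply: (vanish_closed n).2 => //; exact: (vanish_closed n).1.
  suff : coboundary (C := reduced_complex) (toB (x - u) - toB x : reduced_complex n) by [].
  by rewrite xuE subrr; exact: coboundary0.
move=> x dx; case: n x dx => [|n] x dx /=.
  rewrite -[0](raddf0 (@toB 0)) => /toB_eqP; rewrite subr0; exact: cocycle_vanish.
move=> [b _]; have [w <-] := toB_surj b; rewrite [dB _]dB_toB.
(* Likewise [dF (w - u) - x] is a cocycle vanishing on [K], hence 0. *)
move=> /toB_eqP[u u0 wu]; exists (w - u) => //.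
apply/eqP; rewrite -subr_eq0; apply/eqP; rewrite /= dF_additive addrAC.
by apply: cocycle_vanish; rewrite // !dF_additive !dFK dx !subrr.
Qed.

(** * Ranks of the reduced complex *)

Hypothesis Fn : forall n, F_zfree deg n.
Hypothesis hfin : betti_sums_finite deg.
Hypothesis Kpure : forall n, pure (omega KOb n).

Lemma zfree_prod_Ob n A : A `<=` Ob deg n ->
  zfree (prod_on (F n) A) (\sum_(p \in A) R n p).
Proof.
move=> AO; apply: zfree_prod_on => [p /AO dp|]; first by apply: Fn; rewrite dp.
by apply: sub_finite_set (hfin n) => p [/AO].
Qed.

Lemma sum_ObD n : \sum_(p \in Ob deg n `\` K n) R n p =
  (\sum_(p \in Ob deg n) R n p) - \sum_(p \in K n) R n p.
Proof.
(* Splitting the sum requires finite support, since a sum with infinite support is 0 by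
   convention. *)
have fin : finite_set (Ob deg n `&` R n @^-1` [set~ 0]).
  by apply: sub_finite_set (hfin n) => p [dp /eqP].
apply/eqP; rewrite eq_sym subr_eq addrC; apply/eqP.
rewrite fsbig_supp (fsbigID (K n)) // [in RHS]fsbig_supp.
rewrite [X in _ = _ + X]fsbig_supp; congr (_ + _); apply: eq_fsbigl.
  by rewrite setIAC (setIidr (@KOb n)).
by rewrite setIAC.
Qed.

Lemma omega_at n (u : prod_on (F n) (Ob deg n `\` K n)) :
  omega KOb n u = restrict (KOb (n := n.+1)) (dF (extend0 (B := Ob deg n) u)).
Proof. by []. Qed.

Lemma vanish_extend0 n (u : prod_on (F n) (Ob deg n `\` K n)) :
  vanish (extend0 (B := Ob deg n) u).
Proof. by move=> p dp Kp; apply: extend0_out => -[]. Qed.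

Lemma vanish_restrict n (x : C n) : vanish x <-> restrict (KOb (n := n)) x = 0.
Proof.
split=> [x0|x0 p dp Kp]; last by rewrite -(restrict_at (KOb (n := n)) x Kp) x0.
by apply: prod_ext => p Kp; rewrite (restrict_at _ _ _ (KOb Kp)) x0.
Qed.

Lemma vanishE n (x : C n) : vanish x ->
  exists u : prod_on (F n) (Ob deg n `\` K n), extend0 (B := Ob deg n) u = x.
Proof.
move=> x0; exists (restrict (@subDsetl _ (Ob deg n) (K n)) x); apply: prod_ext => p dp.
have [Kp|nKp] := pselect (K n p); first by rewrite x0 // extend0_out // => -[].
have DKp : (Ob deg n `\` K n) p by [].
by rewrite (extend0_at _ DKp) (restrict_at _ _ _ dp).
Qed.

(** [cocycle_vanish] applies twice: to [dF] of the extension of [u], which vanishes on [K n.+1], and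
    then to the extension itself, which vanishes on [K n]. *)
Lemma omega_inj n u : omega KOb n u = 0 -> u = 0.
Proof.
rewrite omega_at => /vanish_restrict du.
have d0 : dF (extend0 (B := Ob deg n) u) = 0 by apply: cocycle_vanish du; exact: dFK.
have u0 := cocycle_vanish d0 (vanish_extend0 u).
apply: prod_ext => p DKp; have dp : Ob deg n p by case: DKp.
by rewrite -(extend0_at u DKp dp) u0.
Qed.

(** The Betti number is the rank of the target minus that of the source, and purity gives the
    torsion-free cokernel. *)
Lemma zfree_coker_omega n : zfree (coker (omega KOb n)) (betti deg K n.+1).
Proof.
have -> : betti deg K n.+1 =
    (\sum_(p \in K n.+1) R n.+1 p) - \sum_(p \in Ob deg n `\` K n) R n p.
  by rewrite /= sum_ObD opprB addrC.
apply: zfree_coker; first by apply: zfree_prod_Ob => p [].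
- exact/zfree_prod_Ob/KOb.
- exact: omega_inj.
move=> v k k0 vk; apply/(quot_class_eq0 (im_closed (omega KOb n))).
have [_ _ /free_abelian_torsionfree tf] := Kpure n; apply: tf k0 _.
by rewrite -raddfMz; apply/(quot_class_eq0 (im_closed (omega KOb n))).
Qed.

Lemma restrict_surj n (y : prod_on (F n) (K n)) :
  exists x : C n, restrict (KOb (n := n)) x = y.
Proof.
exists (extend0 (B := Ob deg n) y); apply: prod_ext => p Kp.
by rewrite (restrict_at _ _ _ (KOb Kp)) (extend0_at _ Kp).
Qed.

(** Restriction to [K n] has kernel [vanish]. In positive degree it carries the differentials of
    families vanishing on the previous [K] onto the range of [omega], because such families are
    extensions by zero. *)
Lemma zfree_reduced_ob n : zfree (B n) (betti deg K n).
Proof.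
case: n => [|n].
  apply: isomorphic_zfree (zfree_prod_Ob (@KOb 0)).
  apply: (@quot_isomorphic _ _ _ _ (restrict (KOb (n := 0)))); first exact: restrict_surj.
  by move=> x; exact: iff_sym (vanish_restrict x).
apply: isomorphic_zfree (zfree_coker_omega n).
pose q := quot_class (im_closed (omega KOb n)).
apply: (@quot_isomorphic _ _ _ _ (q \o restrict (KOb (n := n.+1)) : {additive _ -> _})).
  move=> c; have [x xE] := restrict_surj (quot_repr c).
  by exists x; rewrite /= xE; exact: quot_reprK.
move=> x; have -> : ((q \o restrict (KOb (n := n.+1)) : {additive _ -> _}) x = 0) =
  (quot_class (im_closed (omega KOb n)) (restrict (KOb (n := n.+1)) x) = 0) by [].
rewrite quot_class_eq0; split=> [[u _ ux]|[u u0 /vanish_restrict]].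
  exists (extend0 u); first exact: vanish_extend0.
  apply/vanish_restrict.
  rewrite (raddfB (restrict (KOb (n := n.+1))) x (dF (extend0 u))); apply/eqP.
  by rewrite subr_eq0 eq_sym; exact/eqP/ux.
have [w <-] := vanishE u0; rewrite raddfB => /eqP.
by rewrite subr_eq0 => /eqP ->; exists w.
Qed.

End Reduction.

Theorem theorem5p5 (disp : Order.disp_t) (P : porderType disp) (deg : P -> nat)
    (hdeg : graded deg)
    (hJ : exists J : P -> nat -> set P, local_covering deg J /\ adequate deg J)
    (K : nat -> set P) (hK : global_covering deg K)
    (hfin : betti_sums_finite deg) :
  exists B : cochain,
    (forall n, 0 <= betti deg K n /\ isomorphic (B n) 'rV[int]_`|betti deg K n|) /\
    (forall (I : injective_resolution (constZ P)) (n : nat),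
       isomorphic (cohomology B n) (derived_lim I n)).
Proof.
have [J [lJ aJ]] := hJ; have [KOb [Kinj Kpure]] := hK.
have toinj := to_up_inj hdeg lJ aJ.
(* The complex is built from [deg] and [K] alone, so one choice serves every injective
   resolution. *)
exists (reduced_complex deg K); split=> [n|I n].
  by apply: (zfree_reduced_ob toinj Kinj) => // m; have [] := F_structure hdeg lJ aJ m.
apply: isomorphic_trans (isomorphic_sym (reduced_quasi_iso toinj KOb Kinj n)) _.
have [phi [phi_aug phi_diff]] := comparison_map toinj I.
exact: (comparison_quasi_iso hdeg toinj phi_aug phi_diff).
Qed.
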